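(* Let $D_{\mathcal X}=\mathcal N(\mathbf 0,\boldsymbol\Sigma_{D_{\mathcal X}})$ with $\boldsymbol\Sigma_{D_{\mathcal X}}$ positive definite, and let $\mathbf x_1,\dots,\mathbf x_{2d+2}$ be i.i.d. from $D_{\mathcal X}$. Define, for $i=1,\dots,d$, $\widetilde{\mathbf x}_i=\Big(\sum_{j=d+1}^{2d+2}\mathbf x_j\mathbf x_j^\top\Big)^{1/2}\Big(\sum_{j=1}^{d}\mathbf x_j\mathbf x_j^\top\Big)^{-1/2}\mathbf x_i$. Then $(\widetilde{\mathbf x}_1,\dots,\widetilde{\mathbf x}_d)\sim\mathrm{VS}_{D_{\mathcal X}}^d$.
   Context: For a positive definite matrix $\mathbf A$, $\mathbf A^{1/2}$ denotes the unique lower triangular matrix with positive diagonal entries such that $\mathbf A^{1/2}(\mathbf A^{1/2})^\top=\mathbf A$ (Cholesky factor), and $\mathbf A^{-1/2}:=(\mathbf A^{1/2})^{-1}$. $\mathrm{VS}_{D_{\mathcal X}}^d$ is the probability measure on $(\mathbb R^d)^d$ given by $\mathrm{VS}_{D_{\mathcal X}}^d(A)=\mathbb E_{D_{\mathcal X}^d}[\mathbf 1_A\det(\sum_{i=1}^d\mathbf x_i\mathbf x_i^\top)]/\big(d!\det(\boldsymbol\Sigma_{D_{\mathcal X}})\big)$, where $D_{\mathcal X}^d$ is the law of $d$ i.i.d. draws from $D_{\mathcal X}$. *)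

(* Defs.v *)
From HB Require Import structures.
From mathcomp Require Import all_boot all_order all_algebra.
From mathcomp Require Import all_classical all_reals all_analysis.
Set Implicit Arguments. Unset Strict Implicit. Unset Printing Implicit Defensive.
Import Order.TTheory GRing.Theory Num.Theory.
Local Open Scope classical_set_scope.
Local Open Scope ring_scope.

(* A column vector of R^d seen as a d-tuple (the measurable space of
   d-tuples carries the product sigma-algebra). *)
Definition tup_of_cV {R : realType} {d : nat} (v : 'cV[R]_d) : d.-tuple R :=
  [tuple v i 0 | i < d].

Definition posdef {R : realType} {d : nat} (S : 'M[R]_d) : Prop :=
  S^T = S /\ forall x : 'cV[R]_d, x != 0 -> 0 < (x^T *m S *m x) 0 0.

(* Cholesky factor: the lower triangular L with positive diagonal and
   L L^T = A (unique when A is positive definite; 0 if no such L exists). *)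
Definition chol_spec {R : realType} {d : nat} (A L : 'M[R]_d) : Prop :=
  [/\ (forall i j : 'I_d, (i < j)%N -> L i j = 0),
      (forall i : 'I_d, 0 < L i i) & L *m L^T = A].

Definition chol {R : realType} {d : nat} (A : 'M[R]_d) : 'M[R]_d :=
  xget 0 (chol_spec A).

Definition msqrt {R : realType} {d : nat} (A : 'M[R]_d) : 'M[R]_d := chol A.
Definition minvsqrt {R : realType} {d : nat} (A : 'M[R]_d) : 'M[R]_d :=
  invmx (chol A).

Definition is_gaussian0 {R : realType} {d0 : measure_display}
  {Omega : measurableType d0} (P : probability Omega R) {d : nat}
  (S : 'M[R]_d) (X : Omega -> 'cV[R]_d) : Prop :=
  measurable_fun setT (fun w => tup_of_cV (X w)) /\
  forall a : 'cV[R]_d, a != 0 ->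
  forall B : set R, measurable B ->
    P [set w | B ((a^T *m X w) 0 0)] =
    normal_prob 0 (Num.sqrt ((a^T *m S *m a) 0 0)) B.

Definition mutually_independent {R : realType} {d0 : measure_display}
  {Omega : measurableType d0} (P : probability Omega R) {d n : nat}
  (X : 'I_n -> Omega -> 'cV[R]_d) : Prop :=
  forall B : 'I_n -> set (d.-tuple R), (forall k, measurable (B k)) ->
    P (\bigcap_(k in [set: 'I_n]) [set w | B k (tup_of_cV (X k w))]) =
    (\prod_(k < n) P [set w | B k (tup_of_cV (X k w))])%E.

Lemma leq_d_2d2 (d : nat) : (d <= 2 * d + 2)%N.
Proof. by rewrite mul2n -addnn -addnA leq_addr. Qed.

(* the index of x_{i+1} among x_1..x_{2d+2} (0-based) *)
Definition first_block {d : nat} (i : 'I_d) : 'I_(2 * d + 2) :=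
  widen_ord (leq_d_2d2 d) i.

(* Main.v *)
Require Import Defs.
From HB Require Import structures.
From mathcomp Require Import all_boot all_order all_algebra.
From mathcomp Require Import all_classical all_reals all_analysis.
From mathcomp Require Import measurable_realfun.
From mathcomp Require Import lra ring.
Set Implicit Arguments. Unset Strict Implicit. Unset Printing Implicit Defensive.
Import Order.TTheory GRing.Theory Num.Theory.
Import numFieldNormedType.Exports.
Local Open Scope classical_set_scope.
Local Open Scope ring_scope.

(** Write [M1] and [M2] for the matrices with columns [x_1, ..., x_d] and
    [x_(d+1), ..., x_(2d+2)], and [S1 = M1 M1^T], [S2 = M2 M2^T].

    First, [E (det S1 * f S1) = d! det Sigma * E (f S2)] for every [f >= 0]: it suffices to
    compare Laplace transforms. Weighting a Gaussian vector by [exp (- sum_k t_k (v_k . x)^2)]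
    amounts, up to the factor [det B], to applying some linear map [B] to it. Doing so for every
    column turns [E (det S1)] into [(det B)^d E (det (B M1)^2) = (det B)^(d + 2) d! det Sigma],
    and [(det B)^(d + 2)] is the Laplace transform of [S2].

    Secondly, the law of [M1] is invariant under right multiplication by orthogonal matrices,
    and [M1] is almost surely invertible, so that in [M1 = chol S1 * Q] the orthogonal factor
    [Q] is independent of [S1].

    As the vectors of the statement are the columns of [chol S2 * Q], where [Q] and [S2] are
    independent, these two facts show that their law is that of [M1 = chol S1 * Q] with density
    [det S1 / (d! det Sigma)]. *)

(** * Measurable spaces of matrices *)

Section measurable_sets.
Context {R : realType} {d : measure_display} {T : measurableType d}.

Lemma measurable_forall (I : finType) (A : I -> set T) :
  (forall i, measurable (A i)) -> measurable [set x | forall i, A i x].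
Proof.
move=> mA; rewrite (_ : mkset _ = \bigcap_(i in [set: I]) A i).
  by apply: fin_bigcap_measurable => //; exact: finite_finset.
by apply/seteqP; split => [x Ax i _|x Ax i]; exact: Ax.
Qed.

Lemma measurable_set_ler (f g : T -> R) : measurable_fun setT f ->
  measurable_fun setT g -> measurable [set x | f x <= g x].
Proof.
move=> mf mg; have := measurable_fun_ler mf mg.
by move=> /(_ measurableT [set true] I); rewrite setTI.
Qed.

Lemma measurable_set_ltr (f g : T -> R) : measurable_fun setT f ->
  measurable_fun setT g -> measurable [set x | f x < g x].
Proof.
move=> mf mg; have := measurable_fun_ltr mf mg.
by move=> /(_ measurableT [set true] I); rewrite setTI.
Qed.

Lemma measurable_set_eqr (f g : T -> R) : measurable_fun setT f ->
  measurable_fun setT g -> measurable [set x | f x = g x].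
Proof.
move=> mf mg; rewrite (_ : mkset _ = [set x | f x == g x]).
  have := measurable_fun_eqr mf mg.
  by move=> /(_ measurableT [set true] I); rewrite setTI.
by apply/seteqP; split => x /eqP.
Qed.

Lemma measurable_preimage d' (T' : measurableType d') (f : T -> T') (A : set T') :
  measurable_fun setT f -> measurable A -> measurable (f @^-1` A).
Proof. by move=> mf mA; rewrite -[X in measurable X]setTI; exact: mf. Qed.

End measurable_sets.

Lemma exists_nat_norm_le {R : archiRealFieldType} (I : finType) (f : I -> R) :
  exists N : nat, forall i, `|f i| <= N%:R.
Proof.
exists (\max_i (Num.truncn `|f i|).+1)%N => i.
by apply: le_trans (ltW (truncnS_gt _)) _; rewrite ler_nat; exact: (leq_bigmax i).
Qed.

Section matrix_sigma_algebra.
Context {R : realType} {m n : nat}.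

Definition mx_box (a : 'M[R]_(m, n)) : set 'M[R]_(m, n) :=
  [set M | forall i j, M i j <= a i j].

Definition mx_boxes : set (set 'M[R]_(m, n)) := range mx_box.

HB.instance Definition _ := @isMeasurable.Build default_measure_display
  'M[R]_(m, n) <<s mx_boxes >> (@sigma_algebra0 _ setT mx_boxes)
  (@sigma_algebraC _ mx_boxes) (@sigma_algebra_bigcup _ setT mx_boxes).

Lemma measurable_mx_box (a : 'M[R]_(m, n)) : measurable (mx_box a).
Proof. by apply: sub_sigma_algebra; exists a. Qed.

Lemma mx_boxes_setI : setI_closed mx_boxes.
Proof.
move=> _ _ [a _ <-] [b _ <-].
exists (\matrix_(i, j) Num.min (a i j) (b i j)) => //.
apply/seteqP; split => [M Mab|M [Ma Mb] i j].
  by split=> i j; have := Mab i j; rewrite !mxE le_min => /andP[].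
by rewrite mxE le_min Ma Mb.
Qed.

Lemma bigcup_mx_box (D : pred ('I_m * 'I_n)) (a : 'M[R]_(m, n)) :
  \bigcup_k mx_box (\matrix_(i, j) if D (i, j) then a i j else k%:R) =
  [set M | forall i j, D (i, j) -> M i j <= a i j].
Proof.
apply/seteqP; split => [M [k _ Mk] i j Dij|M Ma].
  by have := Mk i j; rewrite mxE Dij.
have [N MN] := exists_nat_norm_le (fun p => M p.1 p.2).
exists N => //= i j; rewrite mxE; case: ifPn => [|_]; first exact: Ma.
exact: le_trans (ler_norm _) (MN (i, j)).
Qed.

Lemma measurable_mxentry i j : measurable_fun setT (fun M : 'M[R]_(m, n) => M i j).
Proof.
apply: (measurability _ (RGenOInfty.measurableE R)) => //.
move=> _ [_ [x ->] <-]; rewrite setTI.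
rewrite (_ : _ @^-1` _ = ~` (\bigcup_k mx_box
   (\matrix_(i', j') if pred1 (i, j) (i', j') then const_mx x i' j' else k%:R))).
  by apply/measurableC/bigcupT_measurable => k; exact: measurable_mx_box.
rewrite bigcup_mx_box; apply/seteqP; split => M /=; rewrite in_itv/= andbT.
  by move=> xM /(_ i j); rewrite eqxx mxE leNgt xM => /(_ isT).
apply: contra_notP => /negP; rewrite -leNgt => Mx i' j' /eqP[-> ->].
by rewrite mxE.
Qed.

Lemma measurable_mxP d (T : measurableType d) (X : T -> 'M[R]_(m, n)) :
  measurable_fun setT X <-> forall i j, measurable_fun setT (fun x => X x i j).
Proof.
split=> [mX i j|mX]; first exact: (measurableT_comp (measurable_mxentry i j)).
apply: (measurability mx_boxes) => // _ [_ [a _ <-] <-]; rewrite setTI.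
rewrite (_ : _ @^-1` _ = [set x | forall p, X x p.1 p.2 <= a p.1 p.2]).
  by apply: measurable_forall => p; exact: measurable_set_ler.
by apply/seteqP; split => [x Xa p|x Xa i j]; [exact: Xa|exact: (Xa (i, j))].
Qed.

Lemma measure_mx_box_unique (m1 m2 : {finite_measure set 'M[R]_(m, n) -> \bar R}) :
  (forall a, m1 (mx_box a) = m2 (mx_box a)) ->
  forall A, measurable A -> m1 A = m2 A.
Proof.
move=> m12; apply: (measure_unique mx_boxes (fun k => mx_box (const_mx k%:R))) => //.
- exact: mx_boxes_setI.
- by move=> k; exists (const_mx k%:R).
- rewrite -subTset => M _; have /seteqP[_ cover] := @bigcup_mx_box pred0 0.
  have [//|k _ Mk] := cover M; exists k => // i j.
  by have := Mk i j; rewrite !mxE.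
- by move=> _ [a _ <-]; exact: m12.
- by move=> k; rewrite -ge0_fin_numE// fin_num_measure//; exact: measurable_mx_box.
Qed.

End matrix_sigma_algebra.

Section measurable_matrix_operations.
Context {R : realType} {d : measure_display} {T : measurableType d}.

Lemma measurable_funV (f : T -> R) : measurable_fun setT f ->
  measurable_fun setT (fun x => (f x)^-1).
Proof.
suff minv : measurable_fun setT (@GRing.inv R) by exact: (measurableT_comp minv).
have -> : @GRing.inv R = (fun x => if x == 0 then 0 else x^-1).
  by apply/funext => x; case: eqP => // ->; rewrite invr0.
apply: measurable_fun_if => //; first exact: measurable_fun_eqr.
rewrite setTI (_ : _ @^-1` _ = [set x : R | x != 0]); last first.
  by apply/seteqP; split => x /=; case: eqP.
apply: open_continuous_measurable_fun; first exact: open_neq.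
by move=> x; rewrite inE/= => x0; exact: inv_continuous.
Qed.

Lemma measurable_sqrtr (f : T -> R) : measurable_fun setT f ->
  measurable_fun setT (fun x => Num.sqrt (f x)).
Proof.
exact: (measurableT_comp (continuous_measurable_fun (@sqrt_continuous R))).
Qed.

Lemma measurable_expR_funN (f : T -> R) : measurable_fun setT f ->
  measurable_fun setT (fun x => expR (- f x)).
Proof. by move=> mf; apply: measurableT_comp => //; exact: measurableT_comp. Qed.

Lemma measurable_cos_fun (f : T -> R) : measurable_fun setT f ->
  measurable_fun setT (fun x => cos (f x)).
Proof. exact: (measurableT_comp (continuous_measurable_fun (@continuous_cos R))). Qed.

Lemma measurable_addmx m n (X Y : T -> 'M[R]_(m, n)) : measurable_fun setT X ->
  measurable_fun setT Y -> measurable_fun setT (fun x => X x + Y x).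
Proof.
move=> /measurable_mxP mX /measurable_mxP mY; apply/measurable_mxP => i j.
by under eq_fun do rewrite mxE; exact: measurable_funD.
Qed.

Lemma measurable_scalemx m n (f : T -> R) (X : T -> 'M[R]_(m, n)) :
  measurable_fun setT f -> measurable_fun setT X ->
  measurable_fun setT (fun x => f x *: X x).
Proof.
move=> mf /measurable_mxP mX; apply/measurable_mxP => i j.
by under eq_fun do rewrite mxE; exact: measurable_funM.
Qed.

Lemma measurable_mulmx m n p (X : T -> 'M[R]_(m, n)) (Y : T -> 'M[R]_(n, p)) :
  measurable_fun setT X -> measurable_fun setT Y ->
  measurable_fun setT (fun x => X x *m Y x).
Proof.
move=> /measurable_mxP mX /measurable_mxP mY; apply/measurable_mxP => i j.
under eq_fun do rewrite mxE; apply: measurable_sum => k.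
exact: measurable_funM.
Qed.

Lemma measurable_mxsub m n m' n' (f : 'I_m' -> 'I_m) (g : 'I_n' -> 'I_n)
    (X : T -> 'M[R]_(m, n)) : measurable_fun setT X ->
  measurable_fun setT (fun x => mxsub f g (X x)).
Proof.
move=> /measurable_mxP mX; apply/measurable_mxP => i j.
by under eq_fun do rewrite mxE; exact: mX.
Qed.

Lemma measurable_trmx m n (X : T -> 'M[R]_(m, n)) :
  measurable_fun setT X -> measurable_fun setT (fun x => (X x)^T).
Proof.
move=> /measurable_mxP mX; apply/measurable_mxP => i j.
by under eq_fun do rewrite mxE; exact: mX.
Qed.

Lemma measurable_row_mx m n1 n2 (X : T -> 'M[R]_(m, n1)) (Y : T -> 'M[R]_(m, n2)) :
  measurable_fun setT X -> measurable_fun setT Y ->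
  measurable_fun setT (fun x => row_mx (X x) (Y x)).
Proof.
move=> /measurable_mxP mX /measurable_mxP mY; apply/measurable_mxP => i j.
by under eq_fun do rewrite mxE; case: fintype.split => k; [exact: mX|exact: mY].
Qed.

Lemma measurable_col_mx m1 m2 n (X : T -> 'M[R]_(m1, n)) (Y : T -> 'M[R]_(m2, n)) :
  measurable_fun setT X -> measurable_fun setT Y ->
  measurable_fun setT (fun x => col_mx (X x) (Y x)).
Proof.
move=> mX mY; under eq_fun do rewrite -[col_mx _ _]trmxK tr_col_mx.
exact/measurable_trmx/measurable_row_mx/measurable_trmx/mY/measurable_trmx.
Qed.

Lemma measurable_block_mx m1 m2 n1 n2 (X1 : T -> 'M[R]_(m1, n1)) (X2 : T -> 'M[R]_(m1, n2))
    (X3 : T -> 'M[R]_(m2, n1)) (X4 : T -> 'M[R]_(m2, n2)) :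
  measurable_fun setT X1 -> measurable_fun setT X2 ->
  measurable_fun setT X3 -> measurable_fun setT X4 ->
  measurable_fun setT (fun x => block_mx (X1 x) (X2 x) (X3 x) (X4 x)).
Proof. by move=> *; apply: measurable_col_mx; exact: measurable_row_mx. Qed.

Lemma measurable_scalar_mx n (f : T -> R) : measurable_fun setT f ->
  measurable_fun setT (fun x => (f x)%:M : 'M[R]_n).
Proof.
move=> mf; under eq_fun do rewrite -scalemx1.
by apply: measurable_scalemx => //; exact: measurable_cst.
Qed.

Lemma measurable_set_eqmx m n (X Y : T -> 'M[R]_(m, n)) :
  measurable_fun setT X -> measurable_fun setT Y -> measurable [set x | X x = Y x].
Proof.
move=> /measurable_mxP mX /measurable_mxP mY.
rewrite (_ : mkset _ = [set x | forall i j, X x i j = Y x i j]).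
  by apply: measurable_forall => i; apply: measurable_forall => j; exact: measurable_set_eqr.
by apply/seteqP; split => [x /= -> //|x XY]; exact/matrixP.
Qed.

Lemma measurable_det n (X : T -> 'M[R]_n) : measurable_fun setT X ->
  measurable_fun setT (fun x => \det (X x)).
Proof.
move=> /measurable_mxP mX; rewrite /determinant; apply: measurable_sum => s.
by apply: measurable_funM => //; apply: measurable_prod.
Qed.

Lemma measurable_mxtrace n (X : T -> 'M[R]_n) : measurable_fun setT X ->
  measurable_fun setT (fun x => \tr (X x)).
Proof. by move=> /measurable_mxP mX; exact: measurable_sum. Qed.

Lemma measurable_invmx n (X : T -> 'M[R]_n) : measurable_fun setT X ->
  measurable_fun setT (fun x => invmx (X x)).
Proof.
move=> mX; have mdet := measurable_det mX.
have -> : (fun x => invmx (X x)) = (fun x => if \det (X x) == 0 then X x else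
    (\det (X x))^-1 *: \adj (X x)).
  by apply/funext => x; rewrite /invmx unitmxE unitfE; case: eqP.
apply: measurable_fun_ifT => //; first exact: measurable_fun_eqr.
apply: measurable_scalemx; first exact: measurable_funV.
apply/measurable_mxP => i j; under eq_fun do rewrite mxE.
apply: measurable_funM => //; apply: measurable_det.
apply/measurable_mxP => k l; under eq_fun do rewrite !mxE.
by move/measurable_mxP : mX; exact.
Qed.

End measurable_matrix_operations.

(** * Laws and weighted laws *)

Lemma integral_cst_probability {R : realType} {d : measure_display} {T : measurableType d}
    (P : probability T R) (c : \bar R) : (\int[P]_x c = c)%E.
Proof. by rewrite integral_cst//= probability_setT mule1. Qed.

Section law.
Context {R : realType} {d d' : measure_display} {T : measurableType d}
  {V : measurableType d'}.
Variables (P : probability T R) (X : T -> V).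
Hypothesis mX : measurable_fun setT X.

Definition law : probability V R := distribution P (mfun_Sub (mem_set mX)).

Lemma integral_indic_preimage A : measurable A ->
  (\int[P]_x (\1_A (X x))%:E = P (X @^-1` A))%E.
Proof. by move=> mA; rewrite -[X in P X]setIT -integral_indic//; exact: measurable_preimage. Qed.

Lemma ge0_integral_law (f : V -> \bar R) : measurable_fun setT f ->
  (forall v, 0 <= f v)%E -> (\int[law]_v f v = \int[P]_x f (X x))%E.
Proof. exact: ge0_integral_distribution. Qed.

Lemma integral_law (f : V -> \bar R) : measurable_fun setT f ->
  P.-integrable setT (f \o X) -> (\int[law]_v f v = \int[P]_x f (X x))%E.
Proof. by move=> mf intf; rewrite /law integral_distribution. Qed.

End law.

Definition same_law {R : realType} {d1 d2 d' : measure_display}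
    {T1 : measurableType d1} {T2 : measurableType d2} {V : measurableType d'}
    (P1 : probability T1 R) (X1 : T1 -> V) (P2 : probability T2 R) (X2 : T2 -> V) :=
  forall A, measurable A -> P1 (X1 @^-1` A) = P2 (X2 @^-1` A).

Lemma ge0_integral_same_law {R : realType} {d1 d2 d' : measure_display}
    {T1 : measurableType d1} {T2 : measurableType d2} {V : measurableType d'}
    (P1 : probability T1 R) (X1 : T1 -> V) (P2 : probability T2 R) (X2 : T2 -> V)
    (f : V -> \bar R) :
  measurable_fun setT X1 -> measurable_fun setT X2 -> same_law P1 X1 P2 X2 ->
  measurable_fun setT f -> (forall v, 0 <= f v)%E ->
  (\int[P1]_x f (X1 x) = \int[P2]_x f (X2 x))%E.
Proof.
move=> mX1 mX2 X12 mf f0.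
rewrite -(ge0_integral_law P1 mX1 mf f0) -(ge0_integral_law P2 mX2 mf f0).
by apply: eq_measure_integral => A mA _; exact: X12.
Qed.

Section subgraph.
Local Open Scope ereal_scope.
Context {R : realType} {d : measure_display} {V : measurableType d}.
Variable f : V -> \bar R.

Definition subgraph : set (V * R) := [set z | (0 <= z.2)%R /\ z.2%:E < f z.1].

Lemma measurable_subgraph : measurable_fun setT f -> measurable subgraph.
Proof.
move=> mf; apply: (@measurableI _ _ [set z : V * R | 0 <= z.2]%R [set z | z.2%:E < f z.1]).
  by apply: measurable_set_ler => //; exact: measurable_snd.
rewrite -[X in measurable X]setTI; apply: measurable_lte => //.
  by apply/measurable_EFinP; exact: measurable_snd.
exact: (measurableT_comp mf measurable_fst).
Qed.

Lemma integral_indic_subgraph v : 0 <= f v ->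
  \int[lebesgue_measure]_t (\1_subgraph (v, t))%:E = f v.
Proof.
move=> fv_ge0.
transitivity (\int[lebesgue_measure]_t (\1_[set t : R | (0 <= t)%R /\ (t%:E < f v)%E] t)%:E).
  by apply: eq_integral => t _; rewrite !indicE.
case: (f v) fv_ge0 => [r r0||//].
  rewrite (_ : mkset _ = `[0%R, r[%classic); last first.
    by apply/seteqP; split => t /=; rewrite in_itv/= lte_fin => /andP.
  rewrite integral_indic//= setIT lebesgue_measure_itv/= lte_fin oppr0 adde0.
  by move: r0; rewrite lee_fin le_eqVlt => /predU1P[<-|->]; rewrite ?ltxx.
move=> _; rewrite (_ : mkset _ = `[0%R, +oo[%classic).
  by rewrite integral_indic//= setIT lebesgue_measure_itv/= ltry.
by apply/seteqP; split => t /=; rewrite in_itv/= andbT ltry// => -[].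
Qed.

End subgraph.

Section weighted_law.
Local Open Scope ereal_scope.
Context {R : realType} {d d' : measure_display} {T : measurableType d}
  {V : measurableType d'}.
Variables (mu : {sigma_finite_measure set T -> \bar R}) (g : T -> R) (X : T -> V).
Hypotheses (g0 : forall x, (0 <= g x)%R) (ig : mu.-integrable setT (EFin \o g))
  (mX : measurable_fun setT X).

Let mg : measurable_fun setT g.
Proof. exact/measurable_EFinP/(measurable_int mu). Qed.

Let weight (A : set V) : \bar R := \int[mu]_(x in X @^-1` A) (g x)%:E.

Let weight0 : weight set0 = 0.
Proof. by rewrite /weight preimage_set0 integral_set0. Qed.

Let weight_ge0 A : 0 <= weight A.
Proof. by apply: integral_ge0 => x _; rewrite lee_fin. Qed.

Let weight_sigma_additive : semi_sigma_additive weight.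
Proof.
move=> F mF tF mUF; rewrite /weight preimage_bigcup ge0_integral_bigcup//.
- by apply: is_cvg_ereal_nneg_natsum_cond => n _ _; exact: weight_ge0.
- by move=> n; exact: measurable_preimage.
- exact/measurable_funTS/measurable_EFinP.
- by move=> x _; rewrite lee_fin.
- apply/trivIsetP => i j _ _ ij; rewrite -preimage_setI.
  by move/trivIsetP : tF => /(_ _ _ _ _ ij) ->//; rewrite preimage_set0.
Qed.

Let weight_fin : fin_num_fun weight.
Proof.
move=> A mA; apply: integrable_fin_num => //; first exact: measurable_preimage.
by apply: (integrableS measurableT) => //; exact: measurable_preimage.
Qed.

Let weight_measure : {measure set V -> \bar R} :=
  HB.pack weight (isMeasure.Build _ _ _ weight weight0 weight_ge0 weight_sigma_additive).

Definition weighted_law : {finite_measure set V -> \bar R} :=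
  HB.pack weight (Measure.on weight_measure)
    (Measure_isFinite.Build _ _ _ weight_measure weight_fin).

(* Layer cake: writing [f v] as the length of the fiber over [v] of the subgraph of
   [f], both sides are iterated integrals of its indicator function. *)
Lemma ge0_integral_weighted_law (f : V -> \bar R) : measurable_fun setT f ->
  (forall v, 0 <= f v) -> \int[weighted_law]_v f v = \int[mu]_x ((g x)%:E * f (X x)).
Proof.
move=> mf f0; set D := subgraph f.
have mD : measurable D by exact: measurable_subgraph.
have fE v : f v = \int[lebesgue_measure]_t (\1_D (v, t))%:E.
  by rewrite integral_indic_subgraph.
pose F (x : T) (t : R) := (g x)%:E * (\1_D (X x, t))%:E.
have mindD d1 (U : measurableType d1) (h : U -> V * R) : measurable_fun setT h ->
    measurable_fun setT (fun u => (\1_D (h u))%:E : \bar R).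
  move=> mh; apply/measurable_EFinP.
  exact: (measurableT_comp (@measurable_indic _ _ R setT D mD) mh).
have mF : measurable_fun setT (fun z : T * R => F z.1 z.2).
  apply: emeasurable_funM.
    by apply/measurable_EFinP; exact: (measurableT_comp mg measurable_fst).
  apply: mindD.
  exact: (measurable_fun_pair (measurableT_comp mX measurable_fst) measurable_snd).
under eq_integral do rewrite fE.
rewrite (@sfinite_Fubini _ _ _ _ _ weighted_law lebesgue_measure
  (fun z => (\1_D z)%:E)) => //; last exact: mindD.
under [RHS]eq_integral.
  move=> x _; rewrite fE -ge0_integralZl ?lee_fin//; last first.
    exact: (mindD _ _ (pair (X x)) (pair1_measurable (X x))).
  over.
rewrite (@sfinite_Fubini _ _ _ _ _ mu lebesgue_measure
  (fun z => F z.1 z.2)) => [|[x t]|//]; last by rewrite mule_ge0 ?lee_fin.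
apply: eq_integral => t _; pose Dt := [set v | D (v, t)].
have mDt : measurable Dt by exact: measurable_preimage (pair2_measurable t) mD.
rewrite [LHS](_ : _ = \int[weighted_law]_v (\1_Dt v)%:E); last first.
  by apply: eq_integral => v _; rewrite !indicE.
rewrite integral_indic// setIT -[LHS]/(weight Dt) /weight integral_mkcond.
apply: eq_integral => x _; rewrite patchE /F indicE.
rewrite (_ : (x \in _) = ((X x, t) \in D)); last by apply/idP/idP; rewrite !inE.
by case: ifP; rewrite ?mule1 ?mule0.
Qed.

End weighted_law.

(** * Uniqueness of Laplace transforms *)

Lemma finite_bounded_integrable {R : realType} {d : measure_display} {T : measurableType d}
    (mu : {finite_measure set T -> \bar R}) (f : T -> R) (C : R) :
  measurable_fun setT f -> (forall x, `|f x| <= C) -> mu.-integrable setT (EFin \o f).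
Proof.
move=> mf fC; apply: le_integrable (finite_measure_integrable_cst mu C measurableT) => //.
  exact/measurable_EFinP.
by move=> x _; rewrite /= lee_fin (le_trans (fC x))// ler_norm.
Qed.

Section agreement.
Context {R : realType} {d : measure_display} {T : measurableType d}.
Variables m1 m2 : {finite_measure set T -> \bar R}.

Record agree (f : T -> R) : Prop := Agree {
  agree_measurable : measurable_fun setT f;
  agree_bounded : exists C, forall x, `|f x| <= C;
  agree_integral : (\int[m1]_x (f x)%:E = \int[m2]_x (f x)%:E)%E }.

Lemma agree_integrable (mu : {finite_measure set T -> \bar R}) f :
  agree f -> mu.-integrable setT (EFin \o f).
Proof. by case=> mf [C fC] _; exact: finite_bounded_integrable mf fC. Qed.

Lemma agree0 : agree (cst 0).
Proof. by split; [|exists 0 => x; rewrite normr0|rewrite !integral0]. Qed.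

Lemma agreeZ c f : agree f -> agree (fun x => c * f x).
Proof.
move=> af; have [mf [C fC] m12f] := af; split.
- exact: measurable_funM.
- by exists (`|c| * C) => x; rewrite normrM ler_wpM2l.
- under eq_integral do rewrite EFinM.
  rewrite integralZl//; last exact: agree_integrable.
  under [RHS]eq_integral do rewrite EFinM.
  by rewrite integralZl ?m12f//; exact: agree_integrable.
Qed.

Lemma agreeD f g : agree f -> agree g -> agree (fun x => f x + g x).
Proof.
move=> af ag; have [mf [C fC] m12f] := af; have [mg [D gD] m12g] := ag; split.
- exact: measurable_funD.
- by exists (C + D) => x; rewrite (le_trans (ler_normD _ _))// lerD.
- under eq_integral do rewrite EFinD.
  rewrite integralD//; [|exact: agree_integrable..].
  under [RHS]eq_integral do rewrite EFinD.
  by rewrite integralD ?m12f ?m12g//; exact: agree_integrable.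
Qed.

Lemma agreeB f g : agree f -> agree g -> agree (fun x => f x - g x).
Proof.
move=> af ag; under eq_fun do rewrite -mulN1r.
exact: agreeD (agreeZ (- 1) ag).
Qed.

Lemma agree_sum (f_ : nat -> T -> R) n : (forall i, agree (f_ i)) ->
  agree (fun x => \sum_(0 <= i < n) f_ i x).
Proof.
move=> af; elim: n => [|n IH].
  by under eq_fun do rewrite big_nil; exact: agree0.
by under eq_fun do rewrite big_nat_recr//=; exact: agreeD.
Qed.

Lemma agree_cvg (f_ : nat -> T -> R) f C : (forall n, agree (f_ n)) ->
  (forall n x, `|f_ n x| <= C) -> (forall x, f_ n x @[n --> \oo] --> f x) -> agree f.
Proof.
move=> af fC ff.
have mf : measurable_fun setT f.
  by apply: (measurable_fun_cvg (h := f_)) => // n; case: (af n).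
have cvg_int (mu : {finite_measure set T -> \bar R}) :
    (\int[mu]_x (f_ n x)%:E)%E @[n --> \oo] --> (\int[mu]_x (f x)%:E)%E.
  apply: (@dominated_cvg _ _ _ mu _ _ (fun n x => (f_ n x)%:E) _ (cst C%:E)) => //.
  - by move=> n; apply/measurable_EFinP; case: (af n).
  - by move=> x _; apply: cvg_EFin; [exact: nearW|exact: ff].
  - exact: finite_measure_integrable_cst.
  - by move=> n x _ /=; rewrite lee_fin.
split=> //.
  by exists C => x; apply: (cvgr_to_le (cvg_norm (ff x))); exact: nearW.
have := cvg_int m1; rewrite (funext (fun n => agree_integral (af n))) => cvg_m1.
exact: cvg_unique cvg_m1 (cvg_int m2).
Qed.

End agreement.

Lemma norm_series_exp_coeff_le {R : realType} (x : R) n :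
  `|series (exp_coeff x) n| <= expR `|x|.
Proof.
apply: (@le_trans _ _ (series (exp_coeff `|x|) n)).
  rewrite /series/= (le_trans (ler_norm_sum _ _ _))// ler_sum// => i _.
  by rewrite /exp_coeff/= normrM normrX normfV (ger0_norm (ler0n _ _)).
apply: nondecreasing_cvgn_le; last exact: is_cvg_series_exp_coeff.
by apply: nondecreasing_series => i *; exact: exp_coeff_ge0.
Qed.

Lemma cvg_expRN_bound {R : realType} (u : nat -> R) (l : R) :
  (\forall n \near \oo, `|l - u n| <= expR (- n%:R)) -> u n @[n --> \oo] --> l.
Proof.
move=> ul; apply/cvgrPdist_le => e e0.
have : (fun n => expR (- n%:R) : R) @ \oo --> (0 : R).
  have -> : (fun n => expR (- n%:R) : R) = (fun n => expR (- 1) ^+ n).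
    by apply/funext => n; rewrite -expRM_natl mulrN1.
  by apply: cvg_expr; rewrite ger0_norm ?expR_ge0// expR_lt1 oppr_lt0.
move/cvgrPdist_le => /(_ e e0) small.
near=> n; apply: (@le_trans _ _ (expR (- n%:R))); first by near: n.
have : `|0 - expR (- n%:R)| <= e by near: n.
by rewrite sub0r normrN ger0_norm ?expR_ge0.
Unshelve. all: by end_near. Qed.

(* The double exponential is close to 1 when [a < u], because the inner exponent
   then tends to [-oo] quadratically, and to 0 when [u <= a]. *)
Lemma cvg_double_expRN {R : realType} (u a : R) :
  (1 - expR (- (expR (n%:R ^+ 2 * a + n%:R) * expR (- (n%:R ^+ 2 * u))))) @[n --> \oo]
   --> ((u <= a)%R%:R : R).
Proof.
apply: cvg_expRN_bound.
have [ua|au] := leP u a; near=> n.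
  rewrite opprB addrC subrK ger0_norm ?expR_ge0// ler_expR lerN2 -expRD.
  rewrite (le_trans _ (expR_ge1Dx _))//.
  have : 0 <= n%:R ^+ 2 * (a - u) by rewrite mulr_ge0 ?sqr_ge0// subr_ge0.
  lra.
rewrite sub0r normrN -expRD ger0_norm; last first.
  by rewrite subr_ge0 expR_le1 oppr_le0 expR_ge0.
apply: (@le_trans _ _ (expR (n%:R ^+ 2 * a + n%:R - n%:R ^+ 2 * u))).
  by rewrite lerBlDl addrC -lerBlDl (le_trans _ (expR_ge1Dx _))// addrC.
rewrite ler_expR.
have n_large : 2 <= n%:R * (u - a).
  rewrite -ler_pdivrMr ?subr_gt0//; near: n; exact: nbhs_infty_ger.
have : n%:R * 2 <= n%:R * (n%:R * (u - a)) by rewrite ler_wpM2l.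
rewrite expr2; lra.
Unshelve. all: by end_near. Qed.

Section laplace.
Context {R : realType} {d : measure_display} {T : measurableType d}.
Variables m1 m2 : {finite_measure set T -> \bar R}.
Local Notation agree := (agree m1 m2).

Lemma agree_double_expRN (g u : T -> R) (b l : R) : (forall x, 0 <= u x) -> 0 <= l ->
  0 <= b -> (forall t, 0 <= t -> agree (fun x => g x * expR (- (t * u x)))) ->
  agree (fun x => g x * expR (- (b * expR (- (l * u x))))).
Proof.
move=> u0 l0 b0 lap.
have [_ [C gC] _] := lap 0 (lexx _).
apply: (@agree_cvg _ _ _ _ _
  (fun n x => g x * series (exp_coeff (- (b * expR (- (l * u x))))) n) _ (C * expR b)).
- move=> n.
  have -> : (fun x => g x * series (exp_coeff (- (b * expR (- (l * u x))))) n) =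
      (fun x => \sum_(0 <= i < n) (((- b) ^+ i / i`!%:R) * (g x * expR (- ((l *+ i) * u x))))).
    apply/funext => x; rewrite /series/= mulr_sumr; apply: eq_bigr => i _.
    have -> : expR (- (l *+ i * u x)) = expR (- (l * u x)) ^+ i.
      by rewrite -expRM_natl mulr_natl mulrnAl mulNrn.
    by rewrite /exp_coeff/= -mulNr exprMn; ring.
  by apply: agree_sum => i; apply/agreeZ/lap; rewrite mulrn_wge0.
- move=> n x; rewrite normrM ler_pM//.
    by have := gC x; rewrite mul0r oppr0 expR0 mulr1.
  apply: le_trans (norm_series_exp_coeff_le _ _) _.
  rewrite ler_expR normrN normrM (ger0_norm b0) ler_piMr// ger0_norm ?expR_ge0//.
  by rewrite expR_le1 oppr_le0 mulr_ge0.
- by move=> x; apply: cvgMl_tmp; exact: is_cvg_series_exp_coeff.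
Qed.

Lemma agree_sublevel (g u : T -> R) (a : R) : (forall x, 0 <= u x) ->
  (forall t, 0 <= t -> agree (fun x => g x * expR (- (t * u x)))) ->
  agree (fun x => g x * (u x <= a)%R%:R).
Proof.
move=> u0 lap.
have ag : agree g by have := lap 0 (lexx _); under eq_fun do rewrite mul0r oppr0 expR0 mulr1.
have [_ [C gC] _] := ag.
pose h n x : R := expR (- (expR (n%:R ^+ 2 * a + n%:R) * expR (- (n%:R ^+ 2 * u x)))).
apply: (@agree_cvg _ _ _ _ _ (fun n x => g x * (1 - h n x)) _ C) => [n|n x|x].
- under eq_fun do rewrite mulrBr mulr1; apply: (agreeB ag).
  by apply: agree_double_expRN; rewrite ?sqr_ge0 ?expR_ge0.
- rewrite normrM (le_trans _ (gC x))// ler_piMr// ger0_norm.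
    by rewrite gerBl expR_ge0.
  by rewrite subr_ge0 expR_le1 oppr_le0 mulr_ge0 ?expR_ge0.
- by apply: cvgMl_tmp; exact: cvg_double_expRN.
Qed.

Lemma agree_prod_sublevel (I : eqType) (u : I -> T -> R) (s : seq I) (g : T -> R) :
  (forall i x, 0 <= u i x) -> uniq s ->
  (forall t : I -> R, (forall i, 0 <= t i) ->
    agree (fun x => g x * \prod_(i <- s) expR (- (t i * u i x)))) ->
  forall a : I -> R, agree (fun x => g x * \prod_(i <- s) (u i x <= a i)%R%:R).
Proof.
move=> u0; elim: s g => [|i s IH] g.
  by move=> _ lap a; have := lap (fun=> 0) (fun=> lexx _); under eq_fun do rewrite !big_nil;
     under [X in _ -> agree X]eq_fun do rewrite !big_nil.
move=> /= /andP[nis us] lap a; under eq_fun do rewrite big_cons mulrA.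
apply: IH => // t t0; under eq_fun do rewrite mulrAC.
apply: agree_sublevel => // r r0.
pose t' j := if j == i then r else t j.
have /lap : forall j, 0 <= t' j by move=> j; rewrite /t'; case: ifP.
congr agree; apply/funext => x; rewrite big_cons {1}/t' eqxx mulrCA mulrC.
congr (_ * _ * _); apply: eq_big_seq => j js.
by rewrite /t' (negbTE (memPn nis j js)).
Qed.

Lemma laplace_unique (I : finType) (u : I -> T -> R) :
  (forall i, measurable_fun setT (u i)) -> (forall i x, 0 <= u i x) ->
  (forall t : I -> R, (forall i, 0 <= t i) ->
    agree (fun x => \prod_i expR (- (t i * u i x)))) ->
  forall a : I -> R,
    m1 [set x | forall i, u i x <= a i] = m2 [set x | forall i, u i x <= a i].
Proof.
move=> mu u0 lap a; set A := mkset _.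
have mA : measurable A.
  by apply: measurable_forall => i; exact: measurable_set_ler.
have /agree_integral : agree (fun x => 1 * \prod_i (u i x <= a i)%R%:R).
  apply: agree_prod_sublevel => // [|t t0]; first exact: index_enum_uniq.
  by under eq_fun do rewrite mul1r; exact: lap.
have -> : (fun x => (1 * \prod_i (u i x <= a i)%R%:R)%:E) = (fun x => (\1_A x)%:E : \bar R).
  apply/funext => x; congr EFin; rewrite mul1r indicE.
  have [Ax|nAx] := boolP (x \in A).
    by apply: big1 => i _; rewrite (set_mem Ax i).
  have /existsP[i uia] : [exists i, ~~ (u i x <= a i)].
    apply: contraNT nAx => /existsPn ua; rewrite inE => i.
    by have := ua i; rewrite negbK.
  by rewrite (bigD1 i)//= (negbTE uia) mul0r.
by rewrite !integral_indic// !setIT.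
Qed.

End laplace.

Section weighted_law_laplace.
Context {R : realType} {d1 d2 : measure_display}
  {T1 : measurableType d1} {T2 : measurableType d2} {m n : nat}.
Variables (mu1 : {sigma_finite_measure set T1 -> \bar R})
  (mu2 : {sigma_finite_measure set T2 -> \bar R}).
Variables (g1 : T1 -> R) (g2 : T2 -> R) (U1 : T1 -> 'M[R]_(m, n)) (U2 : T2 -> 'M[R]_(m, n)).
Hypotheses (g1_ge0 : forall x, 0 <= g1 x) (g2_ge0 : forall x, 0 <= g2 x).
Hypotheses (ig1 : mu1.-integrable setT (EFin \o g1)) (ig2 : mu2.-integrable setT (EFin \o g2)).
Hypotheses (mU1 : measurable_fun setT U1) (mU2 : measurable_fun setT U2).
Hypotheses (U1_ge0 : forall x i j, 0 <= U1 x i j) (U2_ge0 : forall x i j, 0 <= U2 x i j).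
Hypothesis laplace : forall t : 'I_m * 'I_n -> R, (forall p, 0 <= t p) ->
  (\int[mu1]_x ((g1 x)%:E * (\prod_p expR (- (t p * U1 x p.1 p.2)))%:E) =
   \int[mu2]_x ((g2 x)%:E * (\prod_p expR (- (t p * U2 x p.1 p.2)))%:E))%E.

Let m1 := weighted_law g1_ge0 ig1 mU1.
Let m2 := weighted_law g2_ge0 ig2 mU2.
Let u (p : 'I_m * 'I_n) (M : 'M[R]_(m, n)) : R := `|M p.1 p.2|.

Let mu p : measurable_fun setT (u p).
Proof. by apply: measurableT_comp => //; exact: measurable_mxentry. Qed.

Let agree_laplace (t : 'I_m * 'I_n -> R) : (forall p, 0 <= t p) ->
  agree m1 m2 (fun M => \prod_p expR (- (t p * u p M))).
Proof.
move=> t_ge0.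
have mprod : measurable_fun setT (fun M => \prod_p expR (- (t p * u p M))).
  by apply: measurable_prod => p _; exact/measurable_expR_funN/measurable_funM.
have prod_ge0 M : 0 <= \prod_p expR (- (t p * u p M)).
  by apply: prodr_ge0 => p _; exact: expR_ge0.
split=> //.
  exists 1 => M; rewrite ger0_norm//; apply: prodr_ile1 => p _.
  by rewrite expR_ge0 -expR0 ler_expR oppr_le0 mulr_ge0// normr_ge0.
have mf : measurable_fun setT (fun M => (\prod_p expR (- (t p * u p M)))%:E).
  exact/measurable_EFinP.
rewrite !(ge0_integral_weighted_law _ _ _ mf) => [|M|M]; rewrite ?lee_fin//.
transitivity (\int[mu1]_x ((g1 x)%:E * (\prod_p expR (- (t p * U1 x p.1 p.2)))%:E))%E.
  by apply: eq_integral => x _; under eq_bigr do rewrite /u ger0_norm//.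
apply: etrans (laplace t_ge0) _.
by apply: eq_integral => x _; under [in RHS]eq_bigr do rewrite /u ger0_norm//.
Qed.

Lemma weighted_law_laplace_unique (f : 'M[R]_(m, n) -> \bar R) :
  measurable_fun setT f -> (forall M, 0 <= f M)%E ->
  (\int[mu1]_x ((g1 x)%:E * f (U1 x)) = \int[mu2]_x ((g2 x)%:E * f (U2 x)))%E.
Proof.
move=> mf f0; rewrite -(ge0_integral_weighted_law g1_ge0 ig1 mU1 mf f0).
rewrite -(ge0_integral_weighted_law g2_ge0 ig2 mU2 mf f0).
apply: eq_measure_integral => A mA _; apply: measure_mx_box_unique mA => a.
have boxE T (U : T -> 'M[R]_(m, n)) : (forall x i j, 0 <= U x i j) ->
    U @^-1` mx_box a = U @^-1` [set M | forall p, u p M <= a p.1 p.2].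
  move=> U_ge0; apply/seteqP; split => x Ua.
    by move=> p; rewrite /u ger0_norm.
  by move=> i j; have := Ua (i, j); rewrite /u ger0_norm.
have := laplace_unique mu (fun p M => normr_ge0 _) agree_laplace (fun p => a p.1 p.2).
rewrite -[m1 _]/(\int[mu1]_(x in _) _)%E -[m2 _]/(\int[mu2]_(x in _) _)%E.
by rewrite -(boxE _ _ U1_ge0) -(boxE _ _ U2_ge0).
Qed.

End weighted_law_laplace.

(** * Normal expectations *)

Lemma is_derive_continuous {R : realType} (f : R -> R) (x df : R) :
  is_derive x (1 : R) f df -> {for x, continuous f}.
Proof.
by case=> derivable_f _; apply: differentiable_continuous; exact/derivable1_diffP.
Qed.

Lemma integral_derive_eq0 {R : realType} (F f : R -> R) :
  (forall x, is_derive x (1 : R) F (f x)) -> continuous f ->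
  lebesgue_measure.-integrable setT (EFin \o f) ->
  F n.+1%:R - F (- n.+1%:R) @[n --> \oo] --> 0 ->
  (\int[lebesgue_measure]_x (f x)%:E = 0)%E.
Proof.
move=> dF cf intf F0.
have int_itv n : (\int[lebesgue_measure]_(x in `[(- n.+1%:R)%R, n.+1%:R%R]) (f x)%:E =
    (F n.+1%:R - F (- n.+1%:R))%:E)%E.
  rewrite (@continuous_FTC2 _ _ F) //.
  - by rewrite (@lt_trans _ _ 0)// oppr_lt0.
  - exact: continuous_subspaceT.
  - split.
    + by move=> x _; case: (dF x).
    + by apply: cvg_at_right_filter; exact: is_derive_continuous (dF _).
    + by apply: cvg_at_left_filter; exact: is_derive_continuous (dF _).
  - by move=> x _; rewrite derive1E; case: (dF x).
have cvg_int : ((\int[lebesgue_measure]_(x in `[(- n.+1%:R)%R, n.+1%:R%R]) (f x)%:E)%E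
    @[n --> \oo] --> (\int[lebesgue_measure]_x (f x)%:E)%E).
  under eq_cvg do rewrite integral_mkcond.
  apply: (@dominated_cvg _ _ _ lebesgue_measure _ _ _ _
    (EFin \o (fun x => `|f x|))) => //.
  - move=> n; apply: (measurable_restrictT _ _).1 => //.
    by apply: measurable_funTS; exact: measurable_int intf.
  - move=> x _; apply: cvg_near_cst; near=> n.
    rewrite patchE mem_set//= in_itv/= -ler_norml.
    apply: (@le_trans _ _ n%:R); last by rewrite ler_nat.
    by near: n; exact: nbhs_infty_ger.
  - exact: integrable_norm.
  - by move=> n x _; rewrite patchE; case: ifPn; rewrite //= normr0 lee_fin.
move: cvg_int; rewrite (funext int_itv) => cvg_int.
suff cvg0 : (F n.+1%:R - F (- n.+1%:R))%:E @[n --> \oo] --> 0%E.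
  exact: (cvg_unique _ cvg_int cvg0).
by apply: cvg_EFin; first exact: nearW.
Unshelve. all: by end_near. Qed.

Lemma normal_pdf0E {R : realType} (s x : R) : s != 0 ->
  normal_pdf 0 s x = normal_peak s * expR (- (s ^+ 2 *+ 2)^-1 * x ^+ 2).
Proof.
move=> s_neq0.
by rewrite normal_pdfE// /normal_fun subr0 mulNr mulNr [in LHS](mulrC (x ^+ 2)).
Qed.

Section normal_expectation.
Context {R : realType}.
Variable s : R.
Hypothesis s_neq0 : s != 0.
Local Notation leb := (@lebesgue_measure R).
Local Notation p := (normal_pdf 0 s).
Local Notation q := (normal_pdf 0 (Num.sqrt 2 * s)).
Local Notation N := (normal_prob 0 s).

Lemma ge0_integral_normal_prob (f : R -> \bar R) : measurable_fun setT f ->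
  (forall x, 0 <= f x)%E -> (\int[N]_x f x = \int[leb]_x ((p x)%:E * f x))%E.
Proof.
move=> mf f0.
rewrite -(@ge0_integral_weighted_law _ _ _ _ _ leb p id (normal_pdf_ge0 0 s)
  (integrable_normal_pdf 0 s) (@measurable_id _ _ _) f mf f0).
by apply: eq_measure_integral => A mA _.
Qed.

Lemma integral_normal_prob (f : R -> R) : measurable_fun setT f ->
  (\int[N]_x (f x)%:E = \int[leb]_x (p x * f x)%:E)%E.
Proof.
move=> mf; have mEf : measurable_fun setT (EFin \o f) by exact/measurable_EFinP.
rewrite [LHS]integralE [RHS]integralE.
rewrite ge0_integral_normal_prob; [|exact: measurable_funepos|exact: funepos_ge0].
rewrite ge0_integral_normal_prob; [|exact: measurable_funeneg|exact: funeneg_ge0].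
congr (_ - _)%E; apply: eq_integral => x _.
- by rewrite !funeposE/= EFinM maxe_pMr ?mule0// lee_fin normal_pdf_ge0.
- by rewrite !funenegE/= -mulrN EFinM maxe_pMr ?mule0// lee_fin normal_pdf_ge0.
Qed.

Lemma is_derive_normal_pdf x : is_derive x (1 : R) p (- (x / s ^+ 2) * p x).
Proof.
pose a := - (s ^+ 2 *+ 2)^-1.
have -> : p = cst (normal_peak s) * (expR \o (a *: (id ^+ 2))).
  by apply/funext => y; rewrite normal_pdf0E.
apply: is_derive_eq; rewrite !fctE /GRing.scale/= expr1 mulr0 addr0 mulr1 /a -mulr_natr.
by field; exact: s_neq0.
Qed.

Let sqrt2s_neq0 : Num.sqrt 2 * s != 0.
Proof. by rewrite mulf_neq0// sqrtr_eq0 -ltNge. Qed.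

Let K := 4 * s ^+ 2 * (normal_peak s / normal_peak (Num.sqrt 2 * s)).

Let K_ge0 : 0 <= K.
Proof. by rewrite mulr_ge0 ?divr_ge0 ?normal_peak_ge0// mulr_ge0 ?sqr_ge0. Qed.

(* [x ^+ 2] is absorbed by half of the exponent. *)
Lemma sqr_normal_pdf_le x : x ^+ 2 * p x <= K * q x.
Proof.
pose y := (s ^+ 2 *+ 4)^-1 * x ^+ 2.
rewrite (normal_pdf0E _ s_neq0) (normal_pdf0E _ sqrt2s_neq0) exprMn sqr_sqrtr//.
have -> : - (s ^+ 2 *+ 2)^-1 * x ^+ 2 = - y - y by rewrite /y; field; exact: s_neq0.
have -> : - (2 * s ^+ 2 *+ 2)^-1 * x ^+ 2 = - y by rewrite /y; field; exact: s_neq0.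
have -> : x ^+ 2 = 4 * s ^+ 2 * y by rewrite /y; field; exact: s_neq0.
have y_expRN_le1 : y * expR (- y) <= 1.
  rewrite -ler_pdivlMr ?expR_gt0// expRN invrK mul1r.
  by rewrite (le_trans _ (expR_ge1Dx _))// lerDr.
rewrite {1}expRD.
have -> : 4 * s ^+ 2 * y * (normal_peak s * (expR (- y) * expR (- y))) =
    K * (normal_peak (Num.sqrt 2 * s) * expR (- y)) * (y * expR (- y)).
  by rewrite /K; field; rewrite gt_eqF ?normal_peak_gt0.
by rewrite ler_piMr// mulr_ge0 ?K_ge0// mulr_ge0 ?normal_peak_ge0 ?expR_ge0.
Qed.

Lemma integrable_normal_pdf_quadratic (f : R -> R) (C : R) : measurable_fun setT f ->
  (forall x, `|f x| <= C * (1 + x ^+ 2)) -> leb.-integrable setT (EFin \o (fun x => p x * f x)).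
Proof.
move=> mf fC.
have dom_int : leb.-integrable setT (EFin \o (fun x => C * p x + C * K * q x)).
  have := integrableD measurableT
    (integrableZl measurableT C (integrable_normal_pdf 0 s))
    (integrableZl measurableT (C * K) (integrable_normal_pdf 0 (Num.sqrt 2 * s))).
  by apply: eq_integrable => // x _.
have C_ge0 : 0 <= C.
  by have := le_trans (normr_ge0 _) (fC 0); rewrite expr0n addr0 mulr1.
apply: le_integrable dom_int => //.
  by apply/measurable_EFinP/measurable_funM => //; exact: measurable_normal_pdf.
move=> x _ /=; rewrite lee_fin [leRHS]ger0_norm; last first.
  by rewrite addr_ge0// mulr_ge0 ?normal_pdf_ge0// mulr_ge0.
rewrite normrM ger0_norm ?normal_pdf_ge0//.
apply: le_trans (ler_wpM2l (normal_pdf_ge0 0 s x) (fC x)) _.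
rewrite mulrCA -mulrA -mulrDr ler_wpM2l//.
by rewrite mulrDr mulr1 lerD2l mulrC sqr_normal_pdf_le.
Qed.

Lemma integrable_normal_prob_quadratic (f : R -> R) (C : R) : measurable_fun setT f ->
  (forall x, `|f x| <= C * (1 + x ^+ 2)) -> N.-integrable setT (EFin \o f).
Proof.
move=> mf fC; apply/integrableP; split; first exact/measurable_EFinP.
have mnf : measurable_fun setT (fun x => `|f x|) by exact: measurableT_comp.
rewrite ge0_integral_normal_prob//; last exact/measurable_EFinP.
apply: integrable_lty => //.
by apply: (integrable_normal_pdf_quadratic (C := C)) => // x; rewrite normr_id.
Qed.

Lemma norm_mul_normal_pdf_nat_le (f : R -> R) (C : R) n x :
  (forall x, `|f x| <= C * (1 + `|x|)) -> `|x| = n.+1%:R ->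
  `|f x * p x| <= 2 * C * K * normal_peak (Num.sqrt 2 * s) / n.+1%:R.
Proof.
move=> fC xn; rewrite ler_pdivlMr// -xn normrM (ger0_norm (normal_pdf_ge0 _ _ _)).
have C_ge0 : 0 <= C by have := le_trans (normr_ge0 _) (fC 0); rewrite normr0 addr0 mulr1.
have x_ge1 : 1 <= `|x| by rewrite xn ler1n.
have fx : `|f x| * `|x| <= 2 * C * x ^+ 2.
  rewrite -[x ^+ 2]real_normK ?num_real// expr2 mulrA ler_wpM2r// (le_trans (fC x))//.
  by rewrite -mulrA mulrCA ler_wpM2l//; lra.
have x2p : x ^+ 2 * p x <= K * normal_peak (Num.sqrt 2 * s).
  by rewrite (le_trans (sqr_normal_pdf_le x))// ler_wpM2l ?K_ge0// normal_pdf_ub.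
rewrite mulrAC (le_trans (ler_wpM2r (normal_pdf_ge0 _ _ _) fx))//.
by rewrite -[leLHS]mulrA -[leRHS]mulrA ler_wpM2l// mulr_ge0.
Qed.

Lemma cvg_mul_normal_pdf (f : R -> R) (C : R) : (forall x, `|f x| <= C * (1 + `|x|)) ->
  f n.+1%:R * p n.+1%:R - f (- n.+1%:R) * p (- n.+1%:R) @[n --> \oo] --> 0.
Proof.
move=> fC; apply/norm_cvg0P; set B := 2 * C * K * normal_peak (Num.sqrt 2 * s).
apply: (@squeeze_cvgr _ _ _ _ (cst 0) (fun n => (2 * B) * (n.+1%:R)^-1)).
- apply: nearW => n; rewrite normr_ge0/= (le_trans (ler_normB _ _))//.
  rewrite -[leRHS]mulrA mulr_natl mulr2n.
  by rewrite lerD// norm_mul_normal_pdf_nat_le// ?normrN normr_nat.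
- exact: cvg_cst.
- by rewrite -[X in _ --> X](mulr0 (2 * B)); apply: cvgMl_tmp; exact: cvg_harmonic.
Qed.

Lemma normal_stein (f f' : R -> R) (C : R) : (forall x, is_derive x (1 : R) f (f' x)) ->
  continuous f' -> (forall x, `|f x| <= C * (1 + `|x|)) -> (forall x, `|f' x| <= C) ->
  (\int[N]_x (x * f x) = s ^+ 2 * \int[N]_x (f' x))%R.
Proof.
move=> df cf' fC f'C.
have cf : continuous f by move=> x; exact: is_derive_continuous (df x).
have mf : measurable_fun setT f by exact: continuous_measurable_fun.
have mf' : measurable_fun setT f' by exact: continuous_measurable_fun.
pose F x := s ^+ 2 * (f x * p x).
pose h x := s ^+ 2 * f' x - x * f x.
have dF x : is_derive x (1 : R) F (p x * h x).
  have := df x; have := is_derive_normal_pdf x => dp dfx.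
  apply: (@is_derive_eq _ _ _ (s ^+ 2 *: (f * p))).
  by rewrite /h/= /GRing.scale/=; field.
have F_cvg0 : F n.+1%:R - F (- n.+1%:R) @[n --> \oo] --> 0.
  rewrite -[X in _ --> X](mulr0 (s ^+ 2)); under eq_cvg do rewrite -mulrBr.
  by apply: cvgMl_tmp; exact: cvg_mul_normal_pdf fC.
have C_ge0 : 0 <= C := le_trans (normr_ge0 _) (f'C 0).
have xf_le x : `|x * f x| <= 2 * C * (1 + x ^+ 2).
  rewrite normrM (le_trans (ler_wpM2l (normr_ge0 x) (fC x)))//.
  rewrite mulrCA [2 * C]mulrC -[leRHS]mulrA ler_wpM2l// -[x ^+ 2]real_normK ?num_real//.
  by have := sqr_ge0 (1 - `|x|); have := sqr_ge0 `|x|; lra.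
have f'_le x : `|f' x| <= C * (1 + x ^+ 2).
  by rewrite (le_trans (f'C x))// ler_peMr// lerDl sqr_ge0.
have h_le x : `|h x| <= (s ^+ 2 * C + 2 * C) * (1 + x ^+ 2).
  rewrite (le_trans (ler_normB _ _))// mulrDl lerD// normrM ger0_norm ?sqr_ge0//.
  by rewrite -mulrA ler_wpM2l ?sqr_ge0.
have mxf : measurable_fun setT (fun x : R => x * f x) by exact: measurable_funM.
have mh : measurable_fun setT h by apply: measurable_funB => //; exact: measurable_funM.
have h0 : (\int[N]_x (h x)%:E = 0)%E.
  rewrite integral_normal_prob//; apply: integral_derive_eq0 dF _ _ F_cvg0.
    move=> x; apply: cvgM; first exact: continuous_normal_pdf.
    by apply: cvgB; apply: cvgM => //; [exact: cvg_cst|exact: cf'|exact: cf].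
  exact: integrable_normal_pdf_quadratic mh h_le.
have xf_int := integrable_normal_prob_quadratic mxf xf_le.
have f'_int := integrable_normal_prob_quadratic mf' f'_le.
apply/esym/eqP; rewrite -subr_eq0 -RintegralZl// -RintegralB//=; last first.
  by apply: eq_integrable (integrableZl measurableT (s ^+ 2) f'_int).
by rewrite /Rintegral h0.
Qed.

Lemma normal_second_moment : (\int[N]_x (x ^+ 2)%:E = (s ^+ 2)%:E)%E.
Proof.
have sqr_int : N.-integrable setT (EFin \o (fun x : R => x ^+ 2)).
  apply: (@integrable_normal_prob_quadratic _ 1) => //.
  by move=> x; rewrite mul1r ger0_norm ?sqr_ge0// lerDr.
have stein : (\int[N]_x (x * x))%R = s ^+ 2.
  rewrite (@normal_stein id (cst 1) 1) => [||x|x].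
  - by rewrite Rintegral_cst//= probability_setT/= !mulr1.
  - exact: cst_continuous.
  - by rewrite mul1r lerDr.
  - by rewrite normr1.
by rewrite -stein /Rintegral fineK//; exact: integrable_fin_num sqr_int.
Qed.

Lemma is_derive_affine (x a b : R) : is_derive x (1 : R) (fun y => a * y + b) a.
Proof.
apply: (@is_derive_eq _ _ _ (a *: id + cst b)).
by rewrite /= /GRing.scale/= mulr1 addr0.
Qed.

Lemma measurable_cos_affine a b : measurable_fun setT (fun x : R => cos (x * a + b)).
Proof. by apply: measurable_cos_fun; apply: measurable_funD => //; exact: measurable_funM. Qed.

Lemma integrable_cos_affine a b : N.-integrable setT (EFin \o (fun x => cos (x * a + b))).
Proof.
apply: (@finite_bounded_integrable _ _ _ N _ 1); first exact: measurable_cos_affine.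
by move=> x; exact: cos_max.
Qed.

Lemma is_derive_integral_cos c t :
  is_derive t (1 : R) (fun t => \int[N]_x (cos (x * t + c)))%R
    (\int[N]_x (x * - sin (x * t + c)))%R.
Proof.
pose f t (x : R) := cos (x * t + c).
have df u x : is_derive u (1 : R) (f ^~ x) (x * - sin (x * u + c)).
  apply: (is_derive_eq (@is_derive1_comp _ cos _ u _ _ (is_derive_cos _) (is_derive_affine _ _ _))).
  by rewrite mulrC.
have d1f u x : partial1of2 f u x = x * - sin (x * u + c).
  by rewrite partial1of2E; case: (df u x).
have It : `]t - 1, t + 1[%classic t by rewrite /= in_itv/=; apply/andP; split; lra.
have f_int u : `]t - 1, t + 1[%classic u -> N.-integrable setT (EFin \o f u).
  by move=> _; exact: integrable_cos_affine.
have f_drv u x : `]t - 1, t + 1[%classic u -> setT x -> derivable (f ^~ x) u 1.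
  by move=> _ _; case: (df u x).
have norm_int : N.-integrable setT (EFin \o (fun x => `|x|)).
  apply: (@integrable_normal_prob_quadratic _ 1) => [|x]; first exact: normr_measurable.
  rewrite mul1r normr_id -[x ^+ 2]real_normK ?num_real//.
  by have := sqr_ge0 (1 - `|x|); have := normr_ge0 x; lra.
have d1f_le u x : `]t - 1, t + 1[%classic u -> setT x -> `|partial1of2 f u x| <= `|x|.
  by move=> _ _; rewrite d1f normrM normrN ler_piMr// sin_max.
split; first exact: (derivable_under_integral measurableT It f_int f_drv (@normr_ge0 _ _)
  norm_int d1f_le).
rewrite -derive1E (differentiation_under_integral measurableT It f_int f_drv (@normr_ge0 _ _)
  norm_int d1f_le).
by apply: eq_Rintegral => x _; rewrite d1f.
Qed.

(* The characteristic function solves [F' = - s^2 t F], by Stein's identity. *)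
Lemma is_derive_normal_charfn c t :
  is_derive t (1 : R) (fun t => \int[N]_x (cos (x * t + c)))%R
    (- (s ^+ 2 * t) * \int[N]_x (cos (x * t + c)))%R.
Proof.
have daff x : is_derive x (1 : R) (fun x => x * t + c) t.
  by under eq_fun do rewrite mulrC; exact: is_derive_affine.
have dsin x : is_derive x (1 : R) (fun x => - sin (x * t + c)) (- t * cos (x * t + c)).
  apply: (@is_derive_eq _ _ _ (- (sin \o (fun x => x * t + c)))).
  by rewrite mulNr mulrC.
apply: (is_derive_eq (is_derive_integral_cos c t)).
rewrite (normal_stein (C := 1 + `|t|) dsin) => [|x|x|x].
- by rewrite RintegralZl//; [ring|exact: integrable_cos_affine].
- apply: cvgM; first exact: cvg_cst.
  by apply: (continuous_comp (is_derive_continuous (daff x))); exact: continuous_cos.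
- by rewrite normrN (le_trans (sin_max _))// mulr_ege1// lerDl.
- by rewrite normrM normrN (le_trans (ler_piMr _ (cos_max _)))// lerDr.
Qed.

Lemma normal_charfn t c :
  (\int[N]_x (cos (x * t + c))%:E = (expR (- (s ^+ 2 * t ^+ 2) / 2) * cos c)%:E)%E.
Proof.
pose F t : R := (\int[N]_x (cos (x * t + c)))%R.
have F0 : F 0 = cos c.
  rewrite /F; under eq_Rintegral do rewrite mulr0 add0r.
  by rewrite Rintegral_cst//= probability_setT/= mulr1.
have dFexp u : is_derive u (1 : R) (F * (expR \o (s ^+ 2 / 2 *: (id ^+ 2)))) 0.
  have dF : is_derive u (1 : R) F (- (s ^+ 2 * u) * F u) := is_derive_normal_charfn c u.
  by apply: is_derive_eq; rewrite !fctE /GRing.scale/= expr1 mulr1; field.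
have := is_derive_0_is_cst t 0 dFexp.
rewrite !fctE/= F0 /GRing.scale/= expr0n/= mulr0 expR0 mulr1 => <-.
rewrite mulrCA -expRD (_ : _ + _ = 0) ?expR0 ?mulr1; last by field.
by rewrite /F /Rintegral fineK//; exact: integrable_fin_num (integrable_cos_affine _ _).
Qed.

End normal_expectation.

(** * Uniqueness of characteristic functions *)

Section mxdot.
Context {R : realType}.

Definition mxdot {m n} (A M : 'M[R]_(m, n)) : R := \tr (A^T *m M).

Lemma mxdot_delta m n i j (M : 'M[R]_(m, n)) : mxdot (delta_mx i j) M = M i j.
Proof.
by rewrite /mxdot trmx_delta -(mul_delta_mx (0 : 'I_1)) -mulmxA mxtrace_mulC -rowE -colE
  trace_mx11 !mxE.
Qed.

Lemma mxdotDl m n (A B M : 'M[R]_(m, n)) : mxdot (A + B) M = mxdot A M + mxdot B M.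
Proof. by rewrite /mxdot linearD/= mulmxDl mxtraceD. Qed.

Lemma mxdotZl m n a (A M : 'M[R]_(m, n)) : mxdot (a *: A) M = a * mxdot A M.
Proof. by rewrite /mxdot linearZ/= -scalemxAl mxtraceZ. Qed.

Lemma mxdot0l m n (M : 'M[R]_(m, n)) : mxdot 0 M = 0.
Proof. by rewrite /mxdot trmx0 mul0mx mxtrace0. Qed.

Lemma mxdotC m n (A B : 'M[R]_(m, n)) : mxdot A B = mxdot B A.
Proof. by rewrite /mxdot -mxtrace_tr trmx_mul trmxK. Qed.

Lemma mxdotDr m n (A M N : 'M[R]_(m, n)) : mxdot A (M + N) = mxdot A M + mxdot A N.
Proof. by rewrite ![mxdot A _]mxdotC mxdotDl. Qed.

Lemma mxdotZr m n a (A M : 'M[R]_(m, n)) : mxdot A (a *: M) = a * mxdot A M.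
Proof. by rewrite ![mxdot A _]mxdotC mxdotZl. Qed.

Lemma mxdot_mull m n p (B : 'M[R]_(p, m)) (A : 'M[R]_(p, n)) (M : 'M[R]_(m, n)) :
  mxdot A (B *m M) = mxdot (B^T *m A) M.
Proof. by rewrite /mxdot trmx_mul trmxK mulmxA. Qed.

Lemma mxdot_mulr m n p (W : 'M[R]_(n, p)) (A : 'M[R]_(m, p)) (M : 'M[R]_(m, n)) :
  mxdot A (M *m W) = mxdot (A *m W^T) M.
Proof. by rewrite /mxdot trmx_mul trmxK mulmxA mxtrace_mulC mulmxA. Qed.

Lemma mxdot_row_mx m n1 n2 (A1 M1 : 'M[R]_(m, n1)) (A2 M2 : 'M[R]_(m, n2)) :
  mxdot (row_mx A1 A2) (row_mx M1 M2) = mxdot A1 M1 + mxdot A2 M2.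
Proof. by rewrite /mxdot tr_row_mx mul_col_row mxtrace_block. Qed.

Lemma mxdot_cV d (a x : 'cV[R]_d) : mxdot a x = (a^T *m x) 0 0.
Proof. exact: trace_mx11. Qed.

Lemma measurable_mxdot d (T : measurableType d) m n (A : 'M[R]_(m, n))
  (X : T -> 'M[R]_(m, n)) : measurable_fun setT X ->
  measurable_fun setT (fun x => mxdot A (X x)).
Proof. by move=> mX; apply/measurable_mxtrace/measurable_mulmx. Qed.

End mxdot.

(* The phase [c] encodes the real and imaginary parts together. *)
Definition charfn {R : realType} {d : measure_display} {T : measurableType d}
    (P : probability T R) {m n : nat} (X : T -> 'M[R]_(m, n)) (A : 'M[R]_(m, n)) (c : R) :=
  (\int[P]_w (cos (mxdot A (X w) + c))%:E)%E.

Lemma prod_bounded_integrable {R : realType} {d1 d2 : measure_display}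
    {T1 : measurableType d1} {T2 : measurableType d2}
    (P1 : probability T1 R) (P2 : probability T2 R) (h : T1 * T2 -> R) (C : R) :
  measurable_fun setT h -> (forall z, `|h z| <= C) ->
  (P1 \x P2)%E.-integrable setT (EFin \o h).
Proof.
exact: (@finite_bounded_integrable _ _ _ ((P1 \x P2)%E : probability (T1 * T2)%type R)).
Qed.

(* [expR (- t z^2)] is the characteristic function of a normal variable at [sqrt (2 t) z]. *)
Lemma gauss_smoothing {R : realType} {d : measure_display} {T : measurableType d}
    (P : probability T R) (g z h : T -> R) (C t : R) : 0 <= t ->
  measurable_fun setT g -> (forall x, `|g x| <= C) ->
  measurable_fun setT z -> measurable_fun setT h ->
  (\int[P]_x (g x * expR (- (t * z x ^+ 2)) * cos (h x))%:E =
   \int[normal_prob 0 1]_y \int[P]_x (g x * cos (y * (Num.sqrt (2 * t) * z x) + h x))%:E)%E.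
Proof.
move=> t0 mg gC mz mh.
pose F (p : T * measurableTypeR R) :=
  g p.1 * cos (p.2 * (Num.sqrt (2 * t) * z p.1) + h p.1).
rewrite -(@Fubini _ _ _ _ _ P (normal_prob 0 1) (EFin \o F)).
  apply: eq_integral => x _ /=.
  rewrite /F/=; under eq_integral do rewrite EFinM.
  rewrite integralZl//; last exact: integrable_cos_affine.
  rewrite normal_charfn ?oner_neq0// -EFinM -[in LHS]mulrA; congr (_ * (expR _ * _))%:E.
  by rewrite expr1n mul1r exprMn sqr_sqrtr ?mulr_ge0//; field.
apply: (@prod_bounded_integrable _ _ _ _ _ P (normal_prob 0 1) F C) => [|p].
  apply: measurable_funM; first exact: measurableT_comp.
  apply/measurable_cos_fun/measurable_funD; last exact: measurableT_comp.
  by apply: measurable_funM => //; apply: measurable_funM => //; exact: measurableT_comp.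
by rewrite normrM (le_trans (ler_piMr _ (cos_max _))).
Qed.

Lemma agree_gauss {R : realType} {d : measure_display} {T : measurableType d}
    (P1 P2 : probability T R) (g z h : T -> R) (t : R) : 0 <= t ->
  measurable_fun setT z -> measurable_fun setT h ->
  measurable_fun setT g -> (exists C, forall x, `|g x| <= C) ->
  (forall y, agree P1 P2 (fun x => g x * cos (y * z x + h x))) ->
  agree P1 P2 (fun x => g x * expR (- (t * z x ^+ 2)) * cos (h x)).
Proof.
move=> t0 mz mh mg [C gC] agree_cos; split.
- apply: measurable_funM; last exact: measurable_cos_fun.
  apply/measurable_funM/measurable_expR_funN => //.
  by apply: measurable_funM => //; exact: measurable_funX.
- exists C => x; rewrite normrM (le_trans (ler_piMr _ (cos_max _)))// normrM.
  rewrite (le_trans (ler_piMr _ _))// ger0_norm ?expR_ge0//.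
  by rewrite expR_le1 oppr_le0 mulr_ge0 ?sqr_ge0.
- rewrite !(gauss_smoothing _ t0 mg gC mz mh); apply: eq_integral => y _.
  by under eq_integral do rewrite mulrA; under [RHS]eq_integral do rewrite mulrA;
    exact: agree_integral.
Qed.

Lemma sqrB_le_itv {R : rcfType} (x y r : R) : 0 <= r ->
  ((x - (y - r)) ^+ 2 <= r ^+ 2) = (y - r *+ 2 <= x <= y).
Proof.
move=> r0; rewrite -ler_sqrt ?sqr_ge0// !sqrtr_sqr (ger0_norm r0) ler_norml.
by congr (_ && _); lra.
Qed.

Section charfn_unique.
Context {R : realType} {m n : nat}.
Variables P1 P2 : probability 'M[R]_(m, n) R.
Hypothesis charfn12 : forall A c, charfn P1 id A c = charfn P2 id A c.
Local Notation index := ('I_m * 'I_n)%type.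

Let sqd (y : index -> R) (k : index) (M : 'M[R]_(m, n)) := (M k.1 k.2 - y k) ^+ 2.

Let measurable_sqd y k : measurable_fun setT (sqd y k).
Proof. by apply/measurable_funX/measurable_funB => //; exact: measurable_mxentry. Qed.

Let agree_gauss_cos (t y : index -> R) (s : seq index) A c : (forall k, 0 <= t k) ->
  agree P1 P2 (fun M => \prod_(k <- s) expR (- (t k * sqd y k M)) * cos (mxdot A M + c)).
Proof.
move=> t0; elim: s A c => [|k s IH] A c.
  under eq_fun do rewrite big_nil mul1r; split; last exact: charfn12.
    by apply/measurable_cos_fun/measurable_funD => //; exact: measurable_mxdot.
  by exists 1 => M; exact: cos_max.
under eq_fun do rewrite big_cons [expR _ * _]mulrC; apply: agree_gauss => //.
- by apply: measurable_funB => //; exact: measurable_mxentry.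
- by apply: measurable_funD => //; exact: measurable_mxdot.
- apply: measurable_prod => i _; apply: measurable_expR_funN.
  exact: measurable_funM.
- exists 1 => M; apply: (big_ind (fun r : R => `|r| <= 1)) => [|a b a1 b1|i _].
  + by rewrite normr1.
  + by rewrite normrM mulr_ile1.
  + by rewrite ger0_norm ?expR_ge0// expR_le1 oppr_le0 mulr_ge0// sqr_ge0.
move=> r; have := IH (A + r *: delta_mx k.1 k.2) (c - r * y k).
congr agree; apply/funext => M; congr (_ * cos _).
by rewrite mxdotDl mxdotZl mxdot_delta; ring.
Qed.

Let measure_sqd_le y a : P1 [set M | forall k, sqd y k M <= a k] =
  P2 [set M | forall k, sqd y k M <= a k].
Proof.
apply: laplace_unique => [k|k M|t t0]; [exact: measurable_sqd|exact: sqr_ge0|].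
have := agree_gauss_cos y (index_enum _) 0 0 t0; congr agree; apply/funext => M.
by rewrite mxdot0l addr0 cos0 mulr1.
Qed.

(* A box is the increasing union of the cubes with the same upper corner. *)
Lemma charfn_unique A : measurable A -> P1 A = P2 A.
Proof.
apply: measure_mx_box_unique => b.
pose cube N := [set M | forall k, sqd (fun k => b k.1 k.2 - N%:R) k M <= N%:R ^+ 2].
have box_cubes : mx_box b = \bigcup_N cube N.
  apply/seteqP; split => [M Mb|M [N _ cubeM] i j]; last first.
    by have := cubeM (i, j); rewrite /sqd sqrB_le_itv// => /andP[].
  have [N MN] := exists_nat_norm_le (fun k : index => b k.1 k.2 - M k.1 k.2).
  exists N => // k; rewrite /sqd sqrB_le_itv// Mb andbT lerBlDl -lerBlDr.
  by rewrite mulr2n (le_trans (ler_norm _))// (le_trans (MN k))// lerDl.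
have cube_nd : nondecreasing_seq cube.
  move=> N N' NN'; apply/subsetPset => M cubeM k; have := cubeM k.
  rewrite /sqd !sqrB_le_itv// => /andP[+ ->]; rewrite andbT; apply: le_trans.
  by rewrite lerD2l lerN2 lerMn2r ler_nat NN' orbT.
have mcube N : measurable (cube N).
  by apply: measurable_forall => k; exact: measurable_set_ler.
have cvg_cube (P : probability 'M[R]_(m, n) R) : P (cube N) @[N --> \oo] --> P (mx_box b).
  rewrite box_cubes; apply: nondecreasing_cvg_mu => //.
  by rewrite -box_cubes; exact: measurable_mx_box.
have := cvg_cube P1; rewrite (funext (fun N => measure_sqd_le _ _)) => cvg_P1.
exact: cvg_unique cvg_P1 (cvg_cube P2).
Qed.

End charfn_unique.

(** * Gaussian matrices *)

Section qform.
Context {R : realType}.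

Definition qform {d n} (S : 'M[R]_d) (A : 'M[R]_(d, n)) : R := mxdot A (S *m A).

Lemma qform0 d n (S : 'M[R]_d) : qform S (0 : 'M[R]_(d, n)) = 0.
Proof. exact: mxdot0l. Qed.

Lemma qformZ d n (S : 'M[R]_d) a (A : 'M[R]_(d, n)) : qform S (a *: A) = (a ^+ 2) * qform S A.
Proof. by rewrite /qform -scalemxAr mxdotZl mxdotZr mulrA. Qed.

Lemma qformD d n (S : 'M[R]_d) (A B : 'M[R]_(d, n)) : S^T = S ->
  qform S (A + B) = qform S A + mxdot A (S *m B) *+ 2 + qform S B.
Proof.
move=> St; rewrite /qform mulmxDr mxdotDl !mxdotDr [mxdot B (S *m A)]mxdot_mull St.
by rewrite [mxdot (S *m B) A]mxdotC; ring.
Qed.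

Lemma qform_mull d d' n (S : 'M[R]_d) (B : 'M[R]_(d', d)) (A : 'M[R]_(d', n)) :
  qform (B *m S *m B^T) A = qform S (B^T *m A).
Proof. by rewrite /qform -!mulmxA mxdot_mull. Qed.

Lemma qform_mulr d n p (S : 'M[R]_d) (W : 'M[R]_(n, p)) (A : 'M[R]_(d, p)) :
  W^T *m W = 1%:M -> qform S (A *m W^T) = qform S A.
Proof. by move=> WW; rewrite /qform mulmxA -mxdot_mulr -mulmxA WW mulmx1. Qed.

Lemma qform_row_mx d n1 n2 (S : 'M[R]_d) (A1 : 'M[R]_(d, n1)) (A2 : 'M[R]_(d, n2)) :
  qform S (row_mx A1 A2) = qform S A1 + qform S A2.
Proof. by rewrite /qform mul_mx_row mxdot_row_mx. Qed.

Lemma posdef_qform_gt0 d (S : 'M[R]_d) (a : 'cV[R]_d) : posdef S -> a != 0 -> 0 < qform S a.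
Proof. by move=> [_ S_gt0] a0; rewrite /qform mxdot_cV mulmxA; exact: S_gt0. Qed.

End qform.

(* The columns of [X] are independent centered Gaussian vectors of covariance [S]. *)
Definition gaussian_mx {R : realType} {d0 : measure_display} {T : measurableType d0}
    (P : probability T R) {d n : nat} (S : 'M[R]_d) (X : T -> 'M[R]_(d, n)) :=
  measurable_fun setT X /\
  forall A c, charfn P X A c = (expR (- (qform S A / 2)) * cos c)%:E.

Section cos_mxdot.
Context {R : realType} {d0 : measure_display} {T : measurableType d0}.
Variables (P : probability T R) (d n : nat) (X : T -> 'M[R]_(d, n)).
Hypothesis mX : measurable_fun setT X.

Lemma measurable_cos_mxdot A c : measurable_fun setT (fun x => cos (mxdot A (X x) + c)).
Proof. by apply/measurable_cos_fun/measurable_funD => //; exact: measurable_mxdot. Qed.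

Lemma integrable_cos_mxdot A c :
  P.-integrable setT (fun x => (cos (mxdot A (X x) + c))%:E).
Proof.
apply: (@finite_bounded_integrable _ _ _ P (fun x => cos (mxdot A (X x) + c)) 1).
  exact: measurable_cos_mxdot.
by move=> x; exact: cos_max.
Qed.

End cos_mxdot.

Lemma charfn_law {R : realType} {d0 : measure_display} {T : measurableType d0}
    (P : probability T R) (d n : nat) (X : T -> 'M[R]_(d, n))
    (mX : measurable_fun setT X) A c : charfn (law P mX) id A c = charfn P X A c.
Proof.
apply: (integral_law _ _ (f := fun M => (cos (mxdot A M + c))%:E)).
  by apply/measurable_EFinP/measurable_cos_mxdot.
exact: integrable_cos_mxdot.
Qed.

Section same_law_charfn.
Context {R : realType} {d1 d2 : measure_display}
  {T1 : measurableType d1} {T2 : measurableType d2}.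
Variables (P1 : probability T1 R) (P2 : probability T2 R) (d n : nat).
Variables (X1 : T1 -> 'M[R]_(d, n)) (X2 : T2 -> 'M[R]_(d, n)).
Hypotheses (mX1 : measurable_fun setT X1) (mX2 : measurable_fun setT X2).

Lemma charfn_same_law : (forall A c, charfn P1 X1 A c = charfn P2 X2 A c) ->
  same_law P1 X1 P2 X2.
Proof.
move=> X12; apply: (charfn_unique (P1 := law P1 mX1) (P2 := law P2 mX2)) => A c.
by rewrite !charfn_law.
Qed.

Lemma same_law_charfn A c : same_law P1 X1 P2 X2 -> charfn P1 X1 A c = charfn P2 X2 A c.
Proof.
move=> X12; rewrite -(charfn_law P1 mX1) -(charfn_law P2 mX2).
by apply: eq_measure_integral => B mB _; exact: X12.
Qed.

End same_law_charfn.

Lemma gaussian_mx_same_law {R : realType} {d1 d2 : measure_display}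
    {T1 : measurableType d1} {T2 : measurableType d2}
    (P1 : probability T1 R) (P2 : probability T2 R) (d n : nat) (S : 'M[R]_d)
    (X1 : T1 -> 'M[R]_(d, n)) (X2 : T2 -> 'M[R]_(d, n)) :
  gaussian_mx P1 S X1 -> gaussian_mx P2 S X2 -> same_law P1 X1 P2 X2.
Proof. by move=> [m1 e1] [m2 e2]; apply: charfn_same_law => // A c; rewrite e1 e2. Qed.

Section gaussian_mx_operations.
Context {R : realType} {d0 : measure_display} {T : measurableType d0}.
Variables (P : probability T R) (d n : nat) (S : 'M[R]_d) (X : T -> 'M[R]_(d, n)).
Hypothesis gX : gaussian_mx P S X.

Lemma gaussian_mx_mull d' (B : 'M[R]_(d', d)) :
  gaussian_mx P (B *m S *m B^T) (fun x => B *m X x).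
Proof.
have [mX charX] := gX; split=> [|A c]; first exact: measurable_mulmx.
by rewrite /charfn qform_mull -charX; under eq_integral do rewrite mxdot_mull.
Qed.

Lemma gaussian_mx_mulr p (W : 'M[R]_(n, p)) : W^T *m W = 1%:M ->
  gaussian_mx P S (fun x => X x *m W).
Proof.
move=> WW; have [mX charX] := gX; split=> [|A c]; first exact: measurable_mulmx.
by rewrite -(qform_mulr _ _ WW) -charX /charfn; under eq_integral do rewrite mxdot_mulr.
Qed.

End gaussian_mx_operations.

Lemma gaussian_row_mx {R : realType} {d1 d2 : measure_display}
    {T1 : measurableType d1} {T2 : measurableType d2}
    (P1 : probability T1 R) (P2 : probability T2 R) (d n1 n2 : nat) (S : 'M[R]_d)
    (X1 : T1 -> 'M[R]_(d, n1)) (X2 : T2 -> 'M[R]_(d, n2)) :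
  gaussian_mx P1 S X1 -> gaussian_mx P2 S X2 ->
  gaussian_mx (P1 \x P2)%E S (fun z => row_mx (X1 z.1) (X2 z.2)).
Proof.
move=> [m1 char1] [m2 char2].
have mX : measurable_fun setT (fun z : T1 * T2 => row_mx (X1 z.1) (X2 z.2)).
  by apply: measurable_row_mx; [exact: (measurableT_comp m1)|exact: (measurableT_comp m2)].
split=> // A c; rewrite -[A]hsubmxK; set A1 := lsubmx A; set A2 := rsubmx A.
rewrite /charfn -(@integral12_prod_meas1 _ _ _ _ _ P1 P2
  (fun z => (cos (mxdot (row_mx A1 A2) (row_mx (X1 z.1) (X2 z.2)) + c))%:E)); last first.
  apply: (@prod_bounded_integrable _ _ _ _ _ P1 P2 _ 1) => [|z]; last exact: cos_max.
  exact: measurable_cos_mxdot.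
transitivity (\int[P1]_x ((expR (- (qform S A2 / 2)))%:E * (cos (mxdot A1 (X1 x) + c))%:E))%E.
  apply: eq_integral => x _; rewrite /fubini_F -EFinM -char2.
  by apply: eq_integral => y _; rewrite mxdot_row_mx addrCA addrA [X in X + c]addrC.
rewrite integralZl//; last exact: integrable_cos_mxdot.
by rewrite [X in (_ * X)%E]char1 -EFinM mulrA -expRD qform_row_mx; congr (expR _ * _)%:E; field.
Qed.

Lemma measurable_cV_of_tup {R : realType} {d0 : measure_display} {T : measurableType d0}
    (d : nat) (X : T -> 'cV[R]_d) :
  measurable_fun setT (fun w => tup_of_cV (X w)) -> measurable_fun setT X.
Proof.
move=> mX; apply/measurable_mxP => i j; rewrite (ord1 j).
rewrite (_ : (fun w => _) = (fun w => tnth (tup_of_cV (X w)) i)).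
  exact: (measurableT_comp (measurable_tnth i) mX).
by apply/funext => w; rewrite tnth_mktuple.
Qed.

Lemma normal_gaussian_mx {R : realType} (s : R) : s != 0 ->
  gaussian_mx (normal_prob 0 s) (s ^+ 2)%:M (fun z : R => z%:M : 'M[R]_1).
Proof.
move=> s0; split=> [|A c].
  apply/measurable_mxP => i j; under eq_fun do rewrite !ord1 mxE eqxx mulr1n.
  exact: measurable_id.
rewrite /charfn /qform mul_scalar_mx mxdotZr.
under eq_integral do rewrite mxdot_cV mul_mx_scalar !mxE.
by rewrite normal_charfn// mxdot_cV !mxE big_ord1 !mxE -expr2 mulNr.
Qed.

Lemma is_gaussian0_gaussian_mx {R : realType} {d0 : measure_display}
    {T : measurableType d0} (P : probability T R) (d : nat) (S : 'M[R]_d)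
    (X : T -> 'cV[R]_d) : posdef S -> is_gaussian0 P S X -> gaussian_mx P S X.
Proof.
move=> pdS [/measurable_cV_of_tup mX gX]; split=> // a c.
have [->|a0] := eqVneq a 0.
  rewrite qform0 mul0r oppr0 expR0 mul1r /charfn; under eq_integral do rewrite mxdot0l add0r.
  exact: integral_cst_probability.
have q_gt0 := posdef_qform_gt0 pdS a0.
set s := Num.sqrt (qform S a).
have s0 : s != 0 by rewrite gt_eqF// sqrtr_gt0.
have mY : measurable_fun setT ((fun w => mxdot a (X w)) : T -> measurableTypeR R).
  by move=> _ B mB; exact: (measurable_mxdot a mX).
have mcos : measurable_fun setT (fun y : measurableTypeR R => (cos (y * 1 + c))%:E).
  by apply/measurable_EFinP; exact: measurable_cos_affine.
rewrite /charfn; under eq_integral do rewrite -[X in X + c]mulr1.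
rewrite -(integral_law mY mcos); last first.
  by under eq_fun do rewrite mulr1; exact: integrable_cos_mxdot.
rewrite (eq_measure_integral (normal_prob 0 s)) => [|B mB _]; last first.
  rewrite /s /qform mxdot_cV mulmxA; apply: etrans (gX a a0 B mB).
  by congr (P _); apply/seteqP; split => w /=; rewrite mxdot_cV.
by rewrite normal_charfn// expr1n mulr1 sqr_sqrtr ?mulNr// ltW.
Qed.

Definition columns {R : realType} {T : Type} {d n : nat} (X : 'I_n -> T -> 'cV[R]_d) (w : T) :
  'M[R]_(d, n) := \matrix_(i, j) X j w i 0.

Section independent_columns.
Context {R : realType} {d0 : measure_display} {T : measurableType d0}.
Variables (P : probability T R) (d : nat).

Lemma measurable_columns n (X : 'I_n -> T -> 'cV[R]_d) :
  (forall k, measurable_fun setT (X k)) -> measurable_fun setT (columns X).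
Proof.
move=> mX; apply/measurable_mxP => i j; under eq_fun do rewrite mxE.
by have /measurable_mxP := mX j; exact.
Qed.

Lemma mutually_independent_comp m n (phi : 'I_m -> 'I_n) (X : 'I_n -> T -> 'cV[R]_d) :
  injective phi -> mutually_independent P X -> mutually_independent P (X \o phi).
Proof.
move=> phi_inj indX B mB.
pose B' k := if [pick j | phi j == k] is Some j then B j else setT.
have mB' k : measurable (B' k) by rewrite /B'; case: pickP => [j|] _ //; exact: mB.
have B'_phi j : B' (phi j) = B j.
  rewrite /B'; case: pickP => [j' /eqP/phi_inj->//|/(_ j)]; by rewrite eqxx.
have B'_T k : k \notin codom phi -> B' k = setT.
  move=> kphi; rewrite /B'; case: pickP => // j /eqP phij.
  by rewrite -phij codom_f in kphi.
transitivity (P (\bigcap_(k in [set: 'I_n]) [set w | B' k (tup_of_cV (X k w))])).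
  congr (P _); apply/seteqP; split => w Bw k _ /=; last first.
    by have := Bw (phi k) I; rewrite /= B'_phi.
  have [/codomP[j ->]|/B'_T ->//] := boolP (k \in codom phi).
  by rewrite B'_phi; exact: Bw.
rewrite indX// (bigID (mem (codom phi)))/= [X in (_ * X)%E]big1 ?mule1 => [|k /B'_T->].
  have codom_uniq : uniq (codom phi) by exact/injectiveP.
  rewrite -big_uniq// codomE big_map big_enum/=.
  by apply: eq_bigr => k _; rewrite B'_phi.
exact: probability_setT.
Qed.

Lemma independent_columns_box n (X : 'I_n -> T -> 'cV[R]_d) (a : 'M[R]_(d, n)) :
  mutually_independent P X ->
  P (columns X @^-1` mx_box a) = (\prod_(k < n) P (X k @^-1` mx_box (col k a)))%E.
Proof.
move=> indX; pose B k : set (d.-tuple R) := [set t | forall i, tnth t i <= a i k].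
have mB k : measurable (B k).
  by apply: measurable_forall => i; apply: measurable_set_ler => //; exact: measurable_tnth.
have BE k w : B k (tup_of_cV (X k w)) = mx_box (col k a) (X k w).
  apply/propext; split=> [Bw i j|Bw i].
    by have := Bw i; rewrite tnth_mktuple (ord1 j) !mxE.
  by have := Bw i 0; rewrite tnth_mktuple !mxE.
transitivity (\prod_(k < n) P [set w | B k (tup_of_cV (X k w))])%E; last first.
  by apply: eq_bigr => k _; congr (P _); apply/funext => w; exact: BE.
rewrite -indX//; congr (P _); apply/seteqP; split => w aw.
  by move=> k _; rewrite /= BE => i j; rewrite (ord1 j) mxE; have := aw i k; rewrite mxE.
by move=> i k; rewrite mxE; have := aw k I; rewrite /= BE => /(_ i 0); rewrite mxE.
Qed.

Lemma independent_row_mx m n (X : 'I_(m + n) -> T -> 'cV[R]_d) :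
  (forall k, measurable_fun setT (X k)) -> mutually_independent P X ->
  same_law P (columns X) (P \x P)%E
    (fun z => row_mx (columns (X \o lshift n) z.1) (columns (X \o @rshift m n) z.2)).
Proof.
move=> mX indX; set Xl := columns (X \o lshift n); set Xr := columns (X \o @rshift m n).
have mC : measurable_fun setT (columns X) by exact: measurable_columns.
have mXl : measurable_fun setT Xl by apply: measurable_columns => k; exact: mX.
have mXr : measurable_fun setT Xr by apply: measurable_columns => k; exact: mX.
have mrow : measurable_fun setT (fun z : T * T => row_mx (Xl z.1) (Xr z.2)).
  by apply: measurable_row_mx; [exact: (measurableT_comp mXl)|exact: (measurableT_comp mXr)].
apply: (measure_mx_box_unique (m1 := law P mC) (m2 := law (P \x P)%E mrow)) => a.
set al := lsubmx a; set ar := rsubmx a.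
have row_box : (fun z => row_mx (Xl z.1) (Xr z.2)) @^-1` mx_box a =
    (Xl @^-1` mx_box al) `*` (Xr @^-1` mx_box ar).
  apply/seteqP; split => -[w w'] /= => [aw|[awl awr] i j].
    split=> i j; first by have := aw i (lshift n j); rewrite row_mxEl [lsubmx _ _ _]mxE.
    by have := aw i (rshift m j); rewrite row_mxEr [rsubmx _ _ _]mxE.
  case: (split_ordP j) => k ->; first by have := awl i k; rewrite row_mxEl [lsubmx _ _ _]mxE.
  by have := awr i k; rewrite row_mxEr [rsubmx _ _ _]mxE.
transitivity (P (Xl @^-1` mx_box al) * P (Xr @^-1` mx_box ar))%E; last first.
  rewrite -(product_measure1E P P); first by rewrite -row_box.
    exact: measurable_preimage mXl (measurable_mx_box _).
  exact: measurable_preimage mXr (measurable_mx_box _).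
rewrite (independent_columns_box _ (mutually_independent_comp (@lshift_inj m n) indX)).
rewrite (independent_columns_box _ (mutually_independent_comp (@rshift_inj m n) indX)).
apply: etrans (independent_columns_box a indX) _; rewrite big_split_ord/=.
by congr (_ * _)%E; apply: eq_bigr => k _; congr (P (_ @^-1` mx_box _));
  apply/matrixP => i j; rewrite !mxE.
Qed.

Lemma gaussian_columns (S : 'M[R]_d) n (X : 'I_n -> T -> 'cV[R]_d) : posdef S ->
  (forall k, is_gaussian0 P S (X k)) -> mutually_independent P X ->
  gaussian_mx P S (columns X).
Proof.
move=> pdS; elim: n X => [|n IH] X gX indX.
  have mcol : measurable_fun setT (columns X) by apply: measurable_columns => -[].
  split=> // A c; rewrite [A]thinmx0 qform0 mul0r oppr0 expR0 mul1r /charfn.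
  under eq_integral do rewrite mxdot0l add0r.
  exact: integral_cst_probability.
rewrite -[n.+1]/(1 + n)%N in X gX indX *.
have mXt k : measurable_fun setT (fun w => tup_of_cV (X k w)) by case: (gX k).
have mcol : measurable_fun setT (columns X).
  by apply: measurable_columns => k; exact: measurable_cV_of_tup.
have ghead : gaussian_mx P S (columns (X \o lshift n)).
  have -> : columns (X \o lshift n) = X (lshift n 0).
    by apply/funext => w; apply/matrixP => i j; rewrite !mxE !ord1.
  exact: is_gaussian0_gaussian_mx pdS (gX _).
have gtail : gaussian_mx P S (columns (X \o @rshift 1 n)).
  by apply: IH => [k|]; [exact: gX|exact: mutually_independent_comp (@rshift_inj _ _) indX].
have [mrow char_row] := gaussian_row_mx ghead gtail.
split=> // A c; rewrite -char_row; apply: same_law_charfn => //.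
by apply: independent_row_mx => // k; exact: measurable_cV_of_tup.
Qed.

End independent_columns.

(** * Cholesky factors *)

Section cholesky.
Context {R : realType}.

Fixpoint chol_rec n : 'M[R]_n -> 'M[R]_n :=
  match n return 'M[R]_n -> 'M[R]_n with
  | 0 => id
  | n'.+1 => fun A : 'M[R]_(1 + n') =>
      let a := ulsubmx A 0 0 in
      block_mx (Num.sqrt a)%:M 0 ((Num.sqrt a)^-1 *: dlsubmx A)
        (chol_rec (drsubmx A - a^-1 *: (dlsubmx A *m (dlsubmx A)^T)))
  end.

Lemma chol_rec_block n (a : R) (b : 'cV[R]_n) (c : 'rV[R]_n) (C : 'M[R]_n) :
  chol_rec (block_mx a%:M c b C : 'M[R]_(1 + n)) =
  block_mx (Num.sqrt a)%:M 0 ((Num.sqrt a)^-1 *: b) (chol_rec (C - a^-1 *: (b *m b^T))).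
Proof. by rewrite /= block_mxKul block_mxKdl block_mxKdr mxE eqxx mulr1n. Qed.

Lemma chol_rec_trig n (A : 'M[R]_n) (i j : 'I_n) : (i < j)%N -> chol_rec A i j = 0.
Proof.
elim: n A i j => [|n IH] A i j; first by case: i.
rewrite -[n.+1]/(1 + n)%N in A i j *.
case: (split_ordP i) => i' ->; case: (split_ordP j) => j' -> /=.
- by rewrite !ord1 ltnn.
- by rewrite block_mxEur mxE.
- by rewrite ord1.
- by rewrite block_mxEdr ltn_add2l; exact: IH.
Qed.

Lemma trig_block n (L : 'M[R]_(1 + n)) : (forall i j : 'I_(1 + n), (i < j)%N -> L i j = 0) ->
  L = block_mx (ulsubmx L 0 0)%:M 0 (dlsubmx L) (drsubmx L).
Proof.
move=> L_trig; rewrite -[LHS]submxK -mx11_scalar; congr block_mx.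
by apply/matrixP => i j; rewrite !mxE L_trig// ord1.
Qed.

Lemma chol_spec_rec n (A L : 'M[R]_n) : chol_spec A L -> L = chol_rec A.
Proof.
elim: n A L => [|n IH] A L; first by rewrite !flatmx0.
rewrite -[n.+1]/(1 + n)%N in A L *; move=> [L_trig L_gt0 <-{A}].
have l_gt0 : 0 < ulsubmx L 0 0 by rewrite !mxE; exact: L_gt0.
rewrite [in LHS](trig_block L_trig) [in RHS](trig_block L_trig).
set l := ulsubmx L 0 0 in l_gt0 *; set m := dlsubmx L; set L' := drsubmx L.
rewrite tr_block_mx mulmx_block !tr_scalar_mx !trmx0 !mul0mx !mulmx0 !addr0.
rewrite -scalar_mxM -expr2 mul_mx_scalar chol_rec_block sqrtr_sqr gtr0_norm//.
rewrite scalerA mulVf ?gt_eqF// scale1r; congr block_mx.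
have -> : l ^- 2 *: (l *: m *m (l *: m)^T) = m *m m^T.
  rewrite [(l *: m)^T]linearZ/= -scalemxAr -scalemxAl !scalerA -expr2.
  by rewrite mulVf ?scale1r// expf_eq0 gt_eqF.
rewrite [X in X - _]addrC addrK; apply: IH; split=> // [i j ij|i]; last first.
  by rewrite !mxE; exact: L_gt0.
by rewrite !mxE L_trig//= ltn_add2l.
Qed.

Lemma sym_block n (A : 'M[R]_(1 + n)) : A^T = A ->
  A = block_mx (ulsubmx A 0 0)%:M (dlsubmx A)^T (dlsubmx A) (drsubmx A).
Proof. by move=> At; rewrite trmx_dlsub At -mx11_scalar submxK. Qed.

Lemma posdef_block n (a : R) (b : 'cV[R]_n) (C : 'M[R]_n) :
  posdef (block_mx a%:M b^T b C : 'M[R]_(1 + n)) ->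
  0 < a /\ posdef (C - a^-1 *: (b *m b^T)).
Proof.
move=> [At A_gt0].
have quad (x : 'cV[R]_1) (y : 'cV[R]_n) :
    (col_mx x y)^T *m block_mx a%:M b^T b C *m col_mx x y =
    (x^T *m (a *: x) + y^T *m (b *m x)) + (x^T *m (b^T *m y) + y^T *m (C *m y)).
  rewrite tr_col_mx mul_row_block mul_row_col !mulmxDl mul_mx_scalar -!mulmxA.
  by rewrite -scalemxAl -scalemxAr.
have a_gt0 : 0 < a.
  have := A_gt0 (col_mx 1%:M 0); rewrite quad trmx0 !mul0mx !mulmx0 !addr0 trmx1 mul1mx.
  rewrite mxE mxE eqxx mulr1; apply; apply: contraTneq (oner_neq0 R) => /(congr1 usubmx).
  rewrite col_mxKu linear0 => /matrixP/(_ 0 0).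
  by rewrite !mxE eqxx => /eqP ->.
split=> //; split=> [|y y0].
  rewrite linearB/= linearZ/= trmx_mul trmxK; congr (_ - _).
  by move/(congr1 drsubmx) : At; rewrite tr_block_mx !block_mxKdr.
have := A_gt0 (col_mx (- a^-1 *: (b^T *m y)) y); rewrite quad.
have -> : a *: (- a^-1 *: (b^T *m y)) = - (b^T *m y).
  by rewrite scalerA mulrN mulfV ?gt_eqF// scaleN1r.
rewrite mulmxN addrACA addNr add0r -mulmxDr -scalemxAr mulmxA => xy_gt0.
rewrite -mulmxA mulmxBl -scalemxAl addrC -scaleNr; apply: xy_gt0.
by apply: contra_neq y0 => /(congr1 dsubmx); rewrite col_mxKd linear0.
Qed.

Lemma chol_spec_block n (a : R) (b : 'cV[R]_n) (C L : 'M[R]_n) :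
  0 < a -> chol_spec (C - a^-1 *: (b *m b^T)) L ->
  chol_spec (block_mx a%:M b^T b C : 'M[R]_(1 + n))
    (block_mx (Num.sqrt a)%:M 0 ((Num.sqrt a)^-1 *: b) L).
Proof.
move=> a_gt0 [L_trig L_gt0 LL]; have sa_gt0 : 0 < Num.sqrt a by rewrite sqrtr_gt0.
split=> [i j|i|].
- case: (split_ordP i) => i' ->; case: (split_ordP j) => j' -> /=.
  + by rewrite !ord1 ltnn.
  + by rewrite block_mxEur mxE.
  + by rewrite ord1.
  + by rewrite block_mxEdr ltn_add2l; exact: L_trig.
- case: (split_ordP i) => i' ->; last by rewrite block_mxEdr.
  by rewrite block_mxEul mxE !ord1 eqxx.
rewrite tr_block_mx mulmx_block !tr_scalar_mx !trmx0 !mul0mx !mulmx0 !addr0 LL.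
rewrite -scalar_mxM -expr2 sqr_sqrtr ?ltW// linearZ/= mul_scalar_mx mul_mx_scalar.
rewrite !scalerA mulfV ?gt_eqF// !scale1r -scalemxAr -scalemxAl scalerA -invfM -expr2.
by rewrite sqr_sqrtr ?ltW// addrC subrK.
Qed.

Lemma chol_rec_posdef n (A : 'M[R]_n) : posdef A -> chol_spec A (chol_rec A).
Proof.
elim: n A => [|n IH] A pdA; first by split=> [[] | [] | ] //; rewrite !flatmx0.
rewrite -[n.+1]/(1 + n)%N in A pdA *; have [At _] := pdA.
rewrite (sym_block At) in pdA *; have [a_gt0 pdS] := posdef_block pdA.
by rewrite chol_rec_block; exact: chol_spec_block a_gt0 (IH _ pdS).
Qed.

Lemma chol_posdef n (A : 'M[R]_n) : posdef A -> chol_spec A (chol A).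
Proof. by move=> /chol_rec_posdef hA; exact: (xgetPex 0 (ex_intro _ _ hA)). Qed.

Lemma cholE n (A : 'M[R]_n) : chol A =
  if A \in [set A | (forall i, 0 < chol_rec A i i) /\ chol_rec A *m (chol_rec A)^T = A]
  then chol_rec A else 0.
Proof.
rewrite /chol; case: ifPn; rewrite ?inE ?notin_setE /= => AA.
  apply: chol_spec_rec; apply: (xgetPex 0 (ex_intro _ (chol_rec A) _)).
  by case: AA; split=> //; exact: chol_rec_trig.
case: xgetP => // L _ LA; case: AA.
by have := LA; rewrite (chol_spec_rec LA) => -[].
Qed.

Lemma chol_unitmx d (A : 'M[R]_d) : posdef A -> chol A \in unitmx.
Proof.
move=> /chol_posdef[L_trig L_gt0 _]; rewrite unitmxE unitfE det_trig; last exact/is_trig_mxP.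
by apply/prodf_neq0 => i _; rewrite gt_eqF.
Qed.

Lemma posdef_det_gt0 d (A : 'M[R]_d) : posdef A -> 0 < \det A.
Proof.
move=> pdA; have := chol_unitmx pdA; rewrite unitmxE unitfE => detL.
by have [_ _ <-] := chol_posdef pdA; rewrite det_mulmx det_tr -expr2 lt0r sqrf_eq0 detL sqr_ge0.
Qed.

Lemma posdef_gram d (M : 'M[R]_d) : \det M != 0 -> posdef (M *m M^T).
Proof.
move=> detM; split=> [|v v0]; first by rewrite trmx_mul trmxK.
have uM : M^T \in unitmx by rewrite unitmx_tr unitmxE unitfE.
rewrite mulmxA -mulmxA -[v^T *m M]trmxK trmx_mul trmxK.
rewrite mxE lt_def sumr_ge0 ?andbT => [|i _]; last by rewrite mxE -expr2 sqr_ge0.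
rewrite psumr_eq0 => [|i _]; last by rewrite mxE -expr2 sqr_ge0.
apply: contra_neqN v0 => /allP Mv0; rewrite -[v](mulKmx uM).
suff -> : M^T *m v = 0 by rewrite mulmx0.
apply/matrixP => i j; rewrite (ord1 j) [RHS]mxE; apply/eqP.
by have := Mv0 i (mem_index_enum i); rewrite [_^T _ _]mxE -expr2 sqrf_eq0.
Qed.

Lemma measurable_chol_rec d (T : measurableType d) n (X : T -> 'M[R]_n) :
  measurable_fun setT X -> measurable_fun setT (fun x => chol_rec (X x)).
Proof.
elim: n X => [//|n IH] X; rewrite -[n.+1]/(1 + n)%N in X * => mX.
have ma : measurable_fun setT (fun x => ulsubmx (X x) 0 0).
  by under eq_fun do rewrite !mxE; move/measurable_mxP : mX; exact.
have mb : measurable_fun setT (fun x => dlsubmx (X x)).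
  by under eq_fun do rewrite dlsubmxEsub; exact: measurable_mxsub.
have msa : measurable_fun setT (fun x => Num.sqrt (ulsubmx (X x) 0 0)).
  exact: measurable_sqrtr.
apply: measurable_block_mx; [| |exact/measurable_scalemx/mb/measurable_funV|apply: IH].
- exact: measurable_scalar_mx.
- exact: measurable_cst.
under eq_fun do rewrite -scaleNr; apply: measurable_addmx.
  by under eq_fun do rewrite drsubmxEsub; exact: measurable_mxsub.
apply: measurable_scalemx; first exact/measurable_funN/measurable_funV.
exact: measurable_mulmx mb (measurable_trmx mb).
Qed.

Lemma measurable_chol d (T : measurableType d) n (X : T -> 'M[R]_n) :
  measurable_fun setT X -> measurable_fun setT (fun x => chol (X x)).
Proof.
move=> mX; suff mchol : measurable_fun setT (@chol R n) by exact: measurableT_comp mX.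
have mrec : measurable_fun setT (@chol_rec n) by apply: measurable_chol_rec; exact: measurable_id.
rewrite (funext (@cholE n)).
apply: measurable_fun_ifT => //; apply: (measurable_fun_bool true); rewrite setTI.
rewrite (_ : _ @^-1` _ = [set A | (forall i, 0 < chol_rec A i i) /\
    chol_rec A *m (chol_rec A)^T = A]); last first.
  by apply/seteqP; split => A; [exact: set_mem|exact: mem_set].
apply: measurableI.
  apply: measurable_forall => i; apply: measurable_set_ltr => //.
  by move/measurable_mxP : mrec; exact.
apply: measurable_set_eqmx; last exact: measurable_id.
exact: measurable_mulmx mrec (measurable_trmx mrec).
Qed.

End cholesky.

(** * Orthogonal factors *)

Section orth_factor.
Context {R : realType} {d : nat}.

(* The factor [Q] in the LQ decomposition of [M], when [M] is invertible. *)
Definition orth_factor (M : 'M[R]_d) : 'M[R]_d := invmx (chol (M *m M^T)) *m M.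

Lemma orth_factorK (M : 'M[R]_d) : \det M != 0 -> chol (M *m M^T) *m orth_factor M = M.
Proof. by move=> detM; rewrite mulKVmx//; exact/chol_unitmx/posdef_gram. Qed.

Lemma orth_factor_orthogonal (M : 'M[R]_d) : \det M != 0 ->
  orth_factor M *m (orth_factor M)^T = 1%:M.
Proof.
move=> detM; have pdMM := posdef_gram detM; have uL := chol_unitmx pdMM.
have [_ _ LL] := chol_posdef pdMM; rewrite /orth_factor.
rewrite trmx_mul mulmxA -[_ *m M *m M^T]mulmxA -[X in _ *m X *m _]LL.
by rewrite trmx_inv mulKmx// mulmxV// unitmx_tr.
Qed.

Lemma gram_mulr m n (M : 'M[R]_(m, n)) (U : 'M[R]_n) : U *m U^T = 1%:M ->
  (M *m U) *m (M *m U)^T = M *m M^T.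
Proof. by move=> UU; rewrite trmx_mul mulmxA -(mulmxA M) UU mulmx1. Qed.

Lemma orth_factor_mulr (M U : 'M[R]_d) : U *m U^T = 1%:M ->
  orth_factor (M *m U) = orth_factor M *m U.
Proof. by move=> UU; rewrite /orth_factor gram_mulr// mulmxA. Qed.

Lemma measurable_gram {d0} {T : measurableType d0} m n (M : T -> 'M[R]_(m, n)) :
  measurable_fun setT M -> measurable_fun setT (fun w => M w *m (M w)^T).
Proof. by move=> mM; exact: measurable_mulmx mM (measurable_trmx mM). Qed.

Lemma measurable_orth_factor {d0} {T : measurableType d0} (M : T -> 'M[R]_d) :
  measurable_fun setT M -> measurable_fun setT (fun w => orth_factor (M w)).
Proof.
move=> mM; apply: measurable_mulmx => //.
exact/measurable_invmx/measurable_chol/measurable_gram.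
Qed.

End orth_factor.

Section orth_factor_independence.
Context {R : realType} {d0 : measure_display} {T : measurableType d0}.
Variables (P : probability T R) (d : nat) (M : T -> 'M[R]_d).
Hypothesis mM : measurable_fun setT M.
Hypothesis det_neq0 : {ae P, forall w, \det (M w) != 0}.
Hypothesis law_mulr : forall U : 'M[R]_d, U *m U^T = 1%:M ->
  same_law P (fun w => M w *m U) P M.

Let S w := M w *m (M w)^T.
Let Q w := orth_factor (M w).

Let mS : measurable_fun setT S. Proof. exact: measurable_gram. Qed.

Let mQ : measurable_fun setT Q. Proof. exact: measurable_orth_factor. Qed.

Lemma integral_orth_factor_mulr (F : 'M[R]_d * 'M[R]_d -> \bar R) U :
  measurable_fun setT F -> (forall z, 0 <= F z)%E -> U *m U^T = 1%:M ->
  (\int[P]_w F (S w, Q w *m U) = \int[P]_w F (S w, Q w))%E.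
Proof.
move=> mF F0 UU.
have mG : measurable_fun setT (fun x : 'M[R]_d => F (x *m x^T, orth_factor x)).
  apply: (measurableT_comp mF); apply: measurable_fun_pair.
    by apply: measurable_gram; exact: measurable_id.
  by apply: measurable_orth_factor; exact: measurable_id.
have mMU : measurable_fun setT (fun w => M w *m U) by exact: measurable_mulmx.
rewrite -(ge0_integral_same_law mMU mM (law_mulr UU) mG (fun=> F0 _)).
by apply: eq_integral => w _; rewrite orth_factor_mulr// gram_mulr.
Qed.

(* Averaging the previous invariance over [U = (Q w')^T] and exchanging the
   roles of [w] and [w'] replaces [Q w] by the independent factor [(Q w')^T]. *)
Lemma integral_gram_orth_factor (F : 'M[R]_d * 'M[R]_d -> \bar R) :
  measurable_fun setT F -> (forall z, 0 <= F z)%E ->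
  (\int[P]_w F (S w, Q w) = \int[P]_w \int[P]_w' F (S w, (Q w')^T))%E.
Proof.
move=> mF F0.
have mQt : measurable_fun setT (fun w => (Q w)^T) by exact: measurable_trmx.
pose G (z : T * T) := F (S z.1, Q z.1 *m (Q z.2)^T).
have mG : measurable_fun setT G.
  apply: (measurableT_comp mF); apply: measurable_fun_pair.
    exact: (measurableT_comp mS).
  by apply: measurable_mulmx; [exact: (measurableT_comp mQ)|exact: (measurableT_comp mQt)].
have G0 z : (0 <= G z)%E by exact: F0.
transitivity (\int[P]_w' \int[P]_w G (w, w'))%E.
  apply: etrans (esym (integral_cst_probability P _)) _.
  apply: ae_eq_integral => //; first exact: (measurable_fun_fubini_tonelli_G (m1 := P) G mG G0).
  apply: filterS det_neq0 => w' /orth_factor_orthogonal QQ _.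
  rewrite /G/= -[LHS](integral_orth_factor_mulr mF F0 (U := (Q w')^T))//.
  by rewrite trmxK; exact: mulmx1C.
rewrite -(fubini_tonelli (m1 := P) (m2 := P) G mG G0).
apply: ae_eq_integral => //; first exact: (measurable_fun_fubini_tonelli_F (m2 := P) G mG G0).
  apply: (measurable_fun_fubini_tonelli_F (m2 := P) (fun z => F (S z.1, (Q z.2)^T))) => //.
  apply: (measurableT_comp mF); apply: measurable_fun_pair.
    exact: (measurableT_comp mS).
  exact: (measurableT_comp mQt).
apply: filterS det_neq0 => w /orth_factor_orthogonal QQ _.
pose H (z : 'M[R]_d * 'M[R]_d) := F (S w, z.2^T).
have mH : measurable_fun setT H.
  apply: (measurableT_comp mF); apply: measurable_fun_pair; first exact: measurable_cst.
  by apply: measurable_trmx; exact: measurable_snd.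
rewrite -(integral_orth_factor_mulr mH (fun=> F0 _) (U := (Q w)^T)).
  by apply: eq_integral => w' _; rewrite /H/= trmx_mul trmxK.
by rewrite trmxK; exact: mulmx1C.
Qed.

End orth_factor_independence.

(** * Gaussian moments and tilting *)

Lemma gaussian_second_moment {R : realType} {d0 : measure_display} {T : measurableType d0}
    (P : probability T R) (d : nat) (S : 'M[R]_d) (x : T -> 'cV[R]_d) (a : 'cV[R]_d) :
  posdef S -> gaussian_mx P S x ->
  (\int[P]_w ((mxdot a (x w) ^+ 2)%:E) = (qform S a)%:E)%E.
Proof.
move=> pdS gx; have [->|a0] := eqVneq a 0.
  by rewrite qform0 integral0_eq// => w _; rewrite mxdot0l expr0n.
have q_gt0 := posdef_qform_gt0 pdS a0; set s := Num.sqrt (qform S a).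
have s0 : s != 0 by rewrite gt_eqF// sqrtr_gt0.
have gax : gaussian_mx P (s ^+ 2)%:M (fun w => a^T *m x w).
  rewrite sqr_sqrtr ?ltW// /qform mxdot_cV mulmxA -mx11_scalar -[X in _ *m X]trmxK.
  exact: gaussian_mx_mull.
have gz := normal_gaussian_mx s0; have [max _] := gax; have [mz _] := gz.
have mf : measurable_fun setT (fun M : 'M[R]_1 => ((M 0 0) ^+ 2)%:E).
  by apply/measurable_EFinP/measurable_funX; exact: measurable_mxentry.
under eq_integral do rewrite mxdot_cV.
rewrite (ge0_integral_same_law max mz (gaussian_mx_same_law gax gz) mf); last first.
  by move=> M; rewrite lee_fin sqr_ge0.
under eq_integral do rewrite mxE eqxx mulr1n.
by rewrite normal_second_moment// sqr_sqrtr// ltW.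
Qed.

Section gaussian_shift.
Context {R : realType} {d0 : measure_display} {T : measurableType d0}.
Variables (P : probability T R) (d n : nat) (S : 'M[R]_d) (X : T -> 'M[R]_(d, n)).
Variables (K : 'M[R]_(d, n)) (s : R).
Hypotheses (S_sym : S^T = S) (gX : gaussian_mx P S X) (qK : qform S K = 1) (s_neq0 : s != 0).

Lemma measurable_gaussian_shift : measurable_fun setT X ->
  measurable_fun setT (fun z : T * measurableTypeR R =>
    X z.1 + (z.2 - mxdot K (X z.1)) *: (S *m K)).
Proof.
move=> mX; apply: measurable_addmx; first exact: (measurableT_comp mX).
apply: measurable_scalemx => //; apply: measurable_funB; first exact: measurable_snd.
by apply: measurable_mxdot; exact: (measurableT_comp mX).
Qed.

Lemma measurable_gaussian_shrink : measurable_fun setT X ->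
  measurable_fun setT (fun w => X w - ((1 - s) * mxdot K (X w)) *: (S *m K)).
Proof.
move=> mX; apply: measurable_addmx => //; under eq_fun do rewrite -scaleNr.
apply: measurable_scalemx => //; apply/measurable_funN/measurable_funM => //.
exact: measurable_mxdot.
Qed.

(* [X - mxdot K X *: (S *m K)] and [mxdot K X] are uncorrelated, hence
   independent: multiplying [mxdot K X] by [s] has the same effect on the law of
   [X] as replacing it by an independent variable [z] of variance [s ^+ 2]. *)
Lemma gaussian_shift : same_law
  (P \x normal_prob 0 s)%E (fun z => X z.1 + (z.2 - mxdot K (X z.1)) *: (S *m K))
  P (fun w => X w - ((1 - s) * mxdot K (X w)) *: (S *m K)).
Proof.
have [mX charX] := gX; have mXz := measurable_gaussian_shift mX.
apply: charfn_same_law => // [|A c]; first exact: measurable_gaussian_shrink.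
set k := mxdot A (S *m K).
have qA t : qform S (A - t *: K) = qform S A - 2 * t * k + t ^+ 2.
  rewrite -scaleNr qformD// qformZ qK -scalemxAr mxdotZr -/k sqrrN; ring.
have dotA t w : mxdot A (X w + t *: (S *m K)) = mxdot A (X w) + t * k.
  by rewrite mxdotDr mxdotZr.
have dotAK t w : mxdot (A - t *: K) (X w) = mxdot A (X w) - t * mxdot K (X w).
  by rewrite mxdotDl -scaleNr mxdotZl mulNr.
rewrite /charfn [RHS](_ : _ = charfn P X (A - (k * (1 - s)) *: K) c); last first.
  apply: eq_integral => w _; rewrite -scaleNr dotA dotAK; congr (cos _)%:E; ring.
rewrite charX qA -(@integral12_prod_meas1 _ _ _ _ _ P (normal_prob 0 s) (fun z =>
  (cos (mxdot A (X z.1 + (z.2 - mxdot K (X z.1)) *: (S *m K)) + c))%:E)); last first.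
  apply: (@prod_bounded_integrable _ _ _ _ _ P (normal_prob 0 s) _ 1) => [|z].
    exact: measurable_cos_mxdot.
  exact: cos_max.
transitivity (\int[P]_w ((expR (- (s ^+ 2 * k ^+ 2) / 2))%:E *
    (cos (mxdot (A - k *: K) (X w) + c))%:E))%E.
  apply: eq_integral => w _; rewrite -EFinM -normal_charfn//.
  by apply: eq_integral => z _ /=; rewrite dotA dotAK; congr (cos _)%:E; ring.
rewrite integralZl//; last exact: integrable_cos_mxdot.
rewrite [X in (_ * X)%E]charX qA -EFinM; congr _%:E.
by rewrite [LHS]mulrA -expRD; congr (expR _ * _); field.
Qed.

Lemma ge0_integral_gaussian_shift (f : 'M[R]_(d, n) -> \bar R) :
  measurable_fun setT f -> (forall M, 0 <= f M)%E ->
  (\int[P]_w f (X w - ((1 - s) * mxdot K (X w)) *: (S *m K))%R =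
   \int[P]_w \int[normal_prob 0 s]_z f (X w + (z - mxdot K (X w)) *: (S *m K))%R)%E.
Proof.
have [mX _] := gX; move=> mf f0.
rewrite -(ge0_integral_same_law (measurable_gaussian_shift mX)
  (measurable_gaussian_shrink mX) gaussian_shift mf f0).
exact: (@fubini_tonelli1 _ _ _ _ _ P (normal_prob 0 s) _
  (measurableT_comp mf (measurable_gaussian_shift mX)) (fun=> f0 _)).
Qed.

End gaussian_shift.

Lemma ge0_integral_normal_prob_tilt {R : realType} (s : R) (f : R -> \bar R) : 0 < s ->
  measurable_fun setT f -> (forall z, 0 <= f z)%E ->
  (\int[normal_prob 0 1]_z ((expR (- ((s ^- 2 - 1) / 2 * z ^+ 2)))%:E * f z) =
   s%:E * \int[normal_prob 0 s]_z f z)%E.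
Proof.
move=> s_gt0 mf f0; have s0 : s != 0 by rewrite gt_eqF.
have mexp : measurable_fun setT (fun z : R => (expR (- ((s ^- 2 - 1) / 2 * z ^+ 2)))%:E).
  apply/measurable_EFinP/measurable_expR_funN/measurable_funM => //.
rewrite !ge0_integral_normal_prob ?oner_eq0//; last 2 first.
- exact: emeasurable_funM.
- by move=> z; rewrite mule_ge0 ?lee_fin ?expR_ge0.
rewrite -ge0_integralZl//; last 3 first.
- apply: emeasurable_funM => //; apply/measurable_EFinP; exact: measurable_normal_pdf.
- by move=> z _; rewrite mule_ge0 ?lee_fin ?normal_pdf_ge0.
- by rewrite lee_fin ltW.
apply: eq_integral => z _; rewrite !muleA -!EFinM; congr (_%:E * _)%E.
have peakE : normal_peak s = s^-1 * normal_peak (1 : R).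
  rewrite /normal_peak -!mulrnAr sqrtrM ?sqr_ge0// sqrtr_sqr gtr0_norm// expr1n mul1r.
  by rewrite invfM.
rewrite !normal_pdf0E ?oner_eq0// peakE -[LHS]mulrA -expRD [RHS]mulrA [s * _]mulrA mulfV// mul1r.
by congr (_ * expR _); rewrite expr1n -[s ^+ 2 *+ 2]mulr_natr; field.
Qed.

Section gaussian_tilt.
Context {R : realType} {d0 : measure_display} {T : measurableType d0}.
Variables (P : probability T R) (d n : nat) (S : 'M[R]_d) (X : T -> 'M[R]_(d, n)).
Variables (K : 'M[R]_(d, n)) (s : R) (f : 'M[R]_(d, n) -> \bar R).
Hypotheses (S_sym : S^T = S) (gX : gaussian_mx P S X) (qK : qform S K = 1) (s_gt0 : 0 < s).
Hypotheses (mf : measurable_fun setT f) (f0 : forall M, (0 <= f M)%E).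

Lemma gaussian_tilt :
  (\int[P]_w ((expR (- ((s ^- 2 - 1) / 2 * mxdot K (X w) ^+ 2)))%:E * f (X w)) =
   s%:E * \int[P]_w f (X w - ((1 - s) * mxdot K (X w)) *: (S *m K))%R)%E.
Proof.
have [mX _] := gX.
pose Y (z : T * measurableTypeR R) := X z.1 + (z.2 - mxdot K (X z.1)) *: (S *m K).
have mY : measurable_fun setT Y by exact: measurable_gaussian_shift.
pose e (z : R) := (expR (- ((s ^- 2 - 1) / 2 * z ^+ 2)))%:E.
have me d' (U : measurableType d') (g : U -> R) : measurable_fun setT g ->
    measurable_fun setT (fun u => e (g u)).
  move=> mg; apply/measurable_EFinP/measurable_expR_funN/measurable_funM => //.
  exact: measurable_funX.
have e0 z : (0 <= e z)%E by rewrite lee_fin expR_ge0.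
have KY w z : mxdot K (Y (w, z)) = z.
  by rewrite mxdotDr mxdotZr -/(qform S K) qK mulr1 addrC subrK.
pose h (M : 'M[R]_(d, n)) := (e (mxdot K M) * f M)%E.
have mh : measurable_fun setT h.
  by apply: emeasurable_funM => //; apply: me; apply: measurable_mxdot; exact: measurable_id.
have h0 M : (0 <= h M)%E by rewrite mule_ge0.
transitivity (\int[P]_w h (X w - ((1 - 1) * mxdot K (X w)) *: (S *m K))%R)%E.
  by apply: eq_integral => w _; rewrite subrr mul0r scale0r subr0.
rewrite !(ge0_integral_gaussian_shift S_sym gX qK)// ?oner_eq0 ?gt_eqF//.
rewrite -ge0_integralZl//; last 3 first.
- exact: measurable_fun_fubini_tonelli_F (measurableT_comp mf mY) (fun=> f0 _).
- by move=> w _; exact: integral_ge0.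
- by rewrite lee_fin ltW.
apply: eq_integral => w _.
have mfY : measurable_fun setT (fun z : R => f (Y (w, z))).
  exact: (measurableT_comp mf (measurableT_comp mY (pair1_measurable w))).
apply: etrans (ge0_integral_normal_prob_tilt s_gt0 mfY (fun=> f0 _)).
by apply: eq_integral => z _; rewrite /h -/(Y (w, z)) KY.
Qed.

End gaussian_tilt.

Lemma det_1sub_mul {R : comNzRingType} n (u : 'cV[R]_n) (v : 'rV[R]_n) :
  \det (1%:M - u *m v) = 1 - (v *m u) 0 0.
Proof.
have eqL : block_mx (1%:M : 'M[R]_1) v u 1%:M =
    block_mx 1%:M 0 u 1%:M *m block_mx 1%:M v 0 (1%:M - u *m v).
  by rewrite mulmx_block !mul1mx !mul0mx !mulmx1 !addr0 addrC subrK.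
have eqR : block_mx (1%:M : 'M[R]_1) v u 1%:M =
    block_mx (1%:M - v *m u) v 0 1%:M *m block_mx 1%:M 0 u 1%:M.
  by rewrite mulmx_block !mulmx1 !mul1mx !mulmx0 !add0r subrK.
have := congr1 determinant eqL; rewrite {1}eqR !det_mulmx !det_lblock !det_ublock !det1 !mul1r.
by rewrite !mulr1 => <-; rewrite det_mx11 !mxE.
Qed.

(* [h] times the centered Gaussian law of covariance [S] is [\det B] times its
   image under the linear map [B]. *)
Definition tilts {R : realType} {d : nat} (S : 'M[R]_d) (h : 'cV[R]_d -> R) (B : 'M[R]_d) :=
  0 <= \det B /\
  forall (d0 : measure_display) (T : measurableType d0) (P : probability T R)
    (x : T -> 'cV[R]_d) (f : 'cV[R]_d -> \bar R),
  gaussian_mx P S x -> measurable_fun setT f -> (forall v, 0 <= f v)%E ->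
  (\int[P]_w ((h (x w))%:E * f (x w)) = (\det B)%:E * \int[P]_w f (B *m x w))%E.

Section tilts.
Context {R : realType} {d : nat}.
Variable S : 'M[R]_d.
Hypothesis pdS : posdef S.

Lemma tilts1 : tilts S (fun=> 1) 1%:M.
Proof.
split=> [|d0 T P x f gx mf f0]; first by rewrite det1.
by rewrite det1 mul1e; apply: eq_integral => w _; rewrite mul1e mul1mx.
Qed.

Lemma tiltsM (h1 h2 : 'cV[R]_d -> R) B1 B2 : measurable_fun setT h2 -> (forall v, 0 <= h2 v) ->
  tilts S h1 B1 -> tilts S (fun v => h2 (B1 *m v)) B2 ->
  tilts S (fun v => h1 v * h2 v) (B1 *m B2).
Proof.
move=> mh2 h20 [B1_ge0 tilt1] [B2_ge0 tilt2].
split=> [|d0 T P x f gx mf f0]; first by rewrite det_mulmx mulr_ge0.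
under eq_integral do rewrite EFinM -muleA.
rewrite (tilt1 _ _ _ _ (fun v => (h2 v)%:E * f v)%E gx); last 2 first.
- by apply: emeasurable_funM => //; exact/measurable_EFinP.
- by move=> v; rewrite mule_ge0 ?lee_fin.
rewrite (tilt2 _ _ _ _ (fun v => f (B1 *m v)) gx) => //; last first.
  by apply: (measurableT_comp mf); apply: measurable_mulmx => //; exact: measurable_cst.
by rewrite det_mulmx EFinM muleA; under [in RHS]eq_integral do rewrite -mulmxA.
Qed.

Lemma exists_tilt (t : R) v : 0 <= t ->
  exists B, tilts S (fun x => expR (- (t * mxdot v x ^+ 2))) B.
Proof.
move=> t0; have [->|v0] := eqVneq v 0.
  exists 1%:M; rewrite (_ : (fun=> _) = (fun=> 1)); first exact: tilts1.
  by apply/funext => x; rewrite mxdot0l expr0n mulr0 oppr0 expR0.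
have q_gt0 := posdef_qform_gt0 pdS v0; set q := qform S v in q_gt0.
pose K := (Num.sqrt q)^-1 *: v; pose s := (Num.sqrt (1 + t * q *+ 2))^-1.
have qK : qform S K = 1 by rewrite qformZ exprVn sqr_sqrtr ?ltW// mulVf ?gt_eqF.
have w_gt0 : 0 < 1 + t * q *+ 2 by rewrite ltr_pwDl// mulrn_wge0// mulr_ge0// ltW.
have s_gt0 : 0 < s by rewrite invr_gt0 sqrtr_gt0.
pose B := 1%:M - ((1 - s) *: (S *m K)) *m K^T.
have detB : \det B = s.
  by rewrite det_1sub_mul -scalemxAr mxE -mxdot_cV -/(qform S K) qK mulr1 subKr.
have BE x : B *m x = x - ((1 - s) * mxdot K x) *: (S *m K).
  rewrite mulmxBl mul1mx -mulmxA [K^T *m x]mx11_scalar -mxdot_cV mul_mx_scalar.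
  by rewrite scalerA [mxdot K x * _]mulrC.
exists B; split=> [|d0 T P x f gx mf f0]; first by rewrite detB ltW.
under [in RHS]eq_integral do rewrite BE.
have [S_sym _] := pdS.
rewrite detB -(gaussian_tilt S_sym gx qK s_gt0 mf f0).
apply: eq_integral => w _; congr ((expR (- _))%:E * _)%E.
rewrite /K mxdotZl exprMn exprVn sqr_sqrtr ?ltW// /s exprVn invrK sqr_sqrtr ?ltW//.
by rewrite -mulr_natr; field; rewrite gt_eqF.
Qed.

Lemma exists_tilt_prod (I : Type) (r : seq I) (t : I -> R) (v : I -> 'cV[R]_d) :
  (forall i, 0 <= t i) ->
  exists B, tilts S (fun x => \prod_(i <- r) expR (- (t i * mxdot (v i) x ^+ 2))) B.
Proof.
move=> t0; elim: r => [|i r [B tiltB]].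
  exists 1%:M; rewrite (_ : (fun=> _) = (fun=> 1)); first exact: tilts1.
  by apply/funext => x; rewrite big_nil.
have [B' tiltB'] := exists_tilt (B^T *m v i) (t0 i).
pose h x := expR (- (t i * mxdot (v i) x ^+ 2)).
have mh : measurable_fun setT h.
  apply/measurable_expR_funN/measurable_funM => //; apply: measurable_funX.
  by apply: measurable_mxdot; exact: measurable_id.
have tilth : tilts S (fun x => h (B *m x)) B'.
  rewrite (_ : (fun=> _) = (fun x => expR (- (t i * mxdot (B^T *m v i) x ^+ 2))))//.
  by apply/funext => x; rewrite /h mxdot_mull.
exists (B *m B'); have := tiltsM mh (fun x => expR_ge0 _) tiltB tilth.
by congr (tilts S _ _); apply/funext => x; rewrite big_cons mulrC.
Qed.

End tilts.

(** * Columns, determinants and invertibility *)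

Section gaussian_blocks.
Context {R : realType} {d0 : measure_display} {T : measurableType d0}.
Variables (P : probability T R) (d m n : nat) (S : 'M[R]_d) (X : T -> 'M[R]_(d, m + n)).
Hypothesis gX : gaussian_mx P S X.

Lemma gaussian_mx_lsubmx : gaussian_mx P S (fun w => lsubmx (X w)).
Proof.
have -> : (fun w => lsubmx (X w)) = (fun w => X w *m col_mx 1%:M 0).
  by apply/funext => w; rewrite -{2}[X w]hsubmxK mul_row_col mulmx1 mulmx0 addr0.
by apply: (gaussian_mx_mulr gX); rewrite tr_col_mx mul_row_col trmx1 mulmx1 mulmx0 addr0.
Qed.

Lemma gaussian_mx_rsubmx : gaussian_mx P S (fun w => rsubmx (X w)).
Proof.
have -> : (fun w => rsubmx (X w)) = (fun w => X w *m col_mx 0 1%:M).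
  by apply/funext => w; rewrite -{2}[X w]hsubmxK mul_row_col mulmx1 mulmx0 add0r.
by apply: (gaussian_mx_mulr gX); rewrite tr_col_mx mul_row_col trmx1 mulmx1 mulmx0 add0r.
Qed.

Lemma ge0_integral_gaussian_blocks (f : 'M[R]_(d, m + n) -> \bar R) :
  measurable_fun setT f -> (forall M, 0 <= f M)%E ->
  (\int[P]_w f (X w) =
   \int[P]_w' \int[P]_w f (row_mx (lsubmx (X w)) (rsubmx (X w'))))%E.
Proof.
move=> mf f0; have grow := gaussian_row_mx gaussian_mx_lsubmx gaussian_mx_rsubmx.
have [mX _] := gX; have [mrow _] := grow.
rewrite (ge0_integral_same_law mX mrow (gaussian_mx_same_law gX grow) mf f0).
exact: (fubini_tonelli2 _ (measurableT_comp mf mrow) (fun=> f0 _)).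
Qed.

End gaussian_blocks.

Lemma measurable_prod_col {R : realType} {d0 : measure_display} {T : measurableType d0} {d n : nat}
    (h : 'cV[R]_d -> R) (Y : T -> 'M[R]_(d, n)) : measurable_fun setT h ->
  measurable_fun setT Y -> measurable_fun setT (fun w => \prod_j h (col j (Y w))).
Proof.
move=> mh mY; apply: measurable_prod => j _; apply: (measurableT_comp mh).
by under eq_fun do rewrite colEsub; exact: measurable_mxsub.
Qed.

Lemma prod_col_row_mx {R : comNzRingType} {d n : nat} (h : 'cV[R]_d -> R) (x : 'cV[R]_d)
    (N : 'M[R]_(d, n)) :
  \prod_j h (col j (row_mx x N)) = h x * \prod_j h (col j N).
Proof.
rewrite big_split_ord big_ord1; congr (h _ * _); last by apply: eq_bigr => k _; rewrite colKr.
by rewrite colKl; apply/matrixP => i k; rewrite !ord1 mxE.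
Qed.

Section gaussian_columns_tilt.
Context {R : realType} {d0 : measure_display} {T : measurableType d0}.
Variables (P : probability T R) (d : nat) (S : 'M[R]_d).
Variables (h : 'cV[R]_d -> R) (B : 'M[R]_d).
Hypotheses (mh : measurable_fun setT h) (h0 : forall v, 0 <= h v) (tiltB : tilts S h B).

Section first_column.
Variables (n : nat) (X : T -> 'M[R]_(d, 1 + n)) (f : 'M[R]_(d, 1 + n) -> \bar R).
Hypotheses (gX : gaussian_mx P S X) (mf : measurable_fun setT f) (f0 : forall M, (0 <= f M)%E).

Definition first_column_average (N : 'M[R]_(d, n)) :=
  (\int[P]_w f (row_mx (B *m lsubmx (X w)) N))%E.

Lemma measurable_first_column_average : measurable_fun setT first_column_average.
Proof.
have [ml _] := gaussian_mx_lsubmx gX.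
apply: (measurable_fun_fubini_tonelli_G (m1 := P)
  (fun z : T * 'M[R]_(d, n) => f (row_mx (B *m lsubmx (X z.1)) z.2))) => //.
apply: (measurableT_comp mf); apply: measurable_row_mx; last exact: measurable_snd.
by apply: measurable_mulmx; [exact: measurable_cst|exact: (measurableT_comp ml)].
Qed.

Lemma tilts_first_column :
  (\int[P]_w ((\prod_j h (col j (X w)))%:E * f (X w)) =
   \int[P]_w ((\prod_j h (col j (rsubmx (X w))))%:E *
     ((\det B)%:E * first_column_average (rsubmx (X w)))))%E.
Proof.
have [_ tilt1] := tiltB; have gl := gaussian_mx_lsubmx gX; have [ml _] := gl.
have cols_ge0 p (Y : 'M[R]_(d, p)) : 0 <= \prod_j h (col j Y) by apply: prodr_ge0.
have mrow N : measurable_fun setT (fun v : 'cV[R]_d => f (row_mx v N)).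
  by apply: (measurableT_comp mf); apply: measurable_row_mx => //; exact: measurable_cst.
rewrite (ge0_integral_gaussian_blocks gX (f := fun M => (\prod_j h (col j M))%:E * f M)%E).
- apply: eq_integral => w' _; set N := rsubmx (X w').
  rewrite -(tilt1 _ _ _ _ (fun v => f (row_mx v N)) gl)// -ge0_integralZl//; last 3 first.
  + apply: emeasurable_funM; last exact: (measurableT_comp (mrow N)).
    exact/measurable_EFinP/(measurableT_comp mh).
  + by move=> w _; rewrite mule_ge0 ?lee_fin.
  + by rewrite lee_fin.
  by apply: eq_integral => w _; rewrite muleA -EFinM prod_col_row_mx mulrC.
- apply: emeasurable_funM => //; apply/measurable_EFinP.
  by apply: (measurable_prod_col (Y := id) mh).
- by move=> M; rewrite mule_ge0 ?lee_fin.
Qed.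

End first_column.

Lemma tilts_columns n (X : T -> 'M[R]_(d, n)) (f : 'M[R]_(d, n) -> \bar R) :
  gaussian_mx P S X -> measurable_fun setT f -> (forall M, 0 <= f M)%E ->
  (\int[P]_w ((\prod_j h (col j (X w)))%:E * f (X w)) =
   (\det B ^+ n)%:E * \int[P]_w f (B *m X w))%E.
Proof.
elim: n X f => [|n IH] X f gX mf f0.
  by rewrite expr0 mul1e; apply: eq_integral => w _; rewrite big_ord0 mul1e !thinmx0.
rewrite -[n.+1]/(1 + n)%N in X f gX mf f0 *; have [B_ge0 _] := tiltB.
have gr := gaussian_mx_rsubmx gX; have [mr _] := gr.
have mg := measurable_first_column_average gX mf f0.
have g_ge0 N : (0 <= first_column_average X f N)%E by exact: integral_ge0.
have mBM k : measurable_fun setT (fun M : 'M[R]_(d, k) => B *m M).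
  by apply: measurable_mulmx => //; exact: measurable_cst.
rewrite tilts_first_column//.
rewrite (IH _ (fun N => (\det B)%:E * first_column_average X f N)%E gr); last 2 first.
- by apply: emeasurable_funM => //; exact: measurable_cst.
- by move=> N; rewrite mule_ge0.
rewrite ge0_integralZl//; last exact: (measurableT_comp mg (measurableT_comp (mBM _) mr)).
rewrite muleA -EFinM -exprSr.
rewrite (ge0_integral_gaussian_blocks gX (measurableT_comp mf (mBM _)) (fun=> f0 _)).
by under [in RHS]eq_integral do under eq_integral do rewrite /= mul_mx_row.
Qed.

End gaussian_columns_tilt.

Section gaussian_standardize.
Context {R : realType} {d0 : measure_display} {T : measurableType d0}.
Variables (P : probability T R) (d n : nat) (S : 'M[R]_d) (X : T -> 'M[R]_(d, n)).
Hypotheses (pdS : posdef S) (gX : gaussian_mx P S X).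

Lemma gaussian_mx_standardize : gaussian_mx P 1%:M (fun w => invmx (chol S) *m X w).
Proof.
have uL := chol_unitmx pdS; have [_ _ LL] := chol_posdef pdS.
have := gaussian_mx_mull gX (invmx (chol S)).
by rewrite -[X in _ *m X *m _]LL mulKmx// trmx_inv mulmxV// unitmx_tr.
Qed.

End gaussian_standardize.

Lemma gaussian_mx_rowsub {R : realType} {d0 : measure_display} {T : measurableType d0}
    (P : probability T R) (d d' n : nat) (f : 'I_d' -> 'I_d) (X : T -> 'M[R]_(d, n)) :
  injective f -> gaussian_mx P 1%:M X -> gaussian_mx P 1%:M (fun w => rowsub f (X w)).
Proof.
move=> f_inj gX; under eq_fun do rewrite -[X _]mul1mx -mul_rowsub_mx.
have -> : 1%:M = rowsub f 1%:M *m 1%:M *m (rowsub f 1%:M)^T :> 'M[R]_d'.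
  rewrite mulmx1 mul_rowsub_mx mul1mx; apply/matrixP => i j.
  by rewrite !mxE eq_sym (inj_eq f_inj).
exact: gaussian_mx_mull.
Qed.

Lemma det_row_mx_expand {R : comNzRingType} d (x : 'cV[R]_(1 + d)) (N : 'M[R]_(1 + d, d)) :
  \det (row_mx x N) = \sum_i x i 0 * ((-1) ^+ i * \det (row' i N)).
Proof.
rewrite (expand_det_col _ (lshift d 0)); apply: eq_bigr => i _.
rewrite row_mxEl /cofactor addn0; congr (_ * (_ * \det (row' i _))).
apply/matrixP => k j; rewrite !mxE.
have -> : lift (lshift d 0) j = rshift 1 j by apply: val_inj; rewrite /= /bump leq0n.
by rewrite (unsplitK (inr _ j)).
Qed.

Section gaussian_det.
Context {R : realType} {d0 : measure_display} {T : measurableType d0}.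
Variable P : probability T R.

Lemma gaussian_det2_standard d (X : T -> 'M[R]_d) : gaussian_mx P 1%:M X ->
  (\int[P]_w (\det (X w) ^+ 2)%:E = (d`!%:R)%:E)%E.
Proof.
elim: d X => [|d IH] X gX.
  under eq_integral do rewrite det_mx00 expr1n.
  exact: integral_cst_probability.
rewrite -[d.+1]/(1 + d)%N in X gX *.
have gl := gaussian_mx_lsubmx gX; have gr := gaussian_mx_rsubmx gX; have [mr _] := gr.
have pd1 : posdef (1%:M : 'M[R]_(1 + d)).
  by rewrite -[1%:M]mulmx1 -{2}trmx1; apply: posdef_gram; rewrite det1 oner_eq0.
have mrow i : measurable_fun setT (fun w => row' i (rsubmx (X w))).
  by under eq_fun do rewrite row'Esub; exact: measurable_mxsub.
have mdet2 n (Y : T -> 'M[R]_n) : measurable_fun setT Y ->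
    measurable_fun setT (fun w => (\det (Y w) ^+ 2)%:E).
  by move=> mY; exact/measurable_EFinP/measurable_funX/measurable_det.
rewrite (ge0_integral_gaussian_blocks gX (f := fun M => (\det M ^+ 2)%:E)); last 2 first.
- by apply/measurable_EFinP/measurable_funX/measurable_det; exact: measurable_id.
- by move=> M; rewrite lee_fin sqr_ge0.
transitivity (\int[P]_w' \sum_i (\det (row' i (rsubmx (X w'))) ^+ 2)%:E)%E.
  apply: eq_integral => w' _; set N := rsubmx (X w').
  pose c : 'cV[R]_(1 + d) := \col_i ((-1) ^+ i * \det (row' i N)).
  under eq_integral => w _.
    rewrite det_row_mx_expand (_ : \sum_i _ = mxdot c (lsubmx (X w))); last first.
      by rewrite mxdot_cV mxE; apply: eq_bigr => i _; rewrite !mxE mulrC.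
    over.
  rewrite (gaussian_second_moment c pd1 gl) /qform mul1mx mxdot_cV mxE sumEFin.
  congr _%:E; apply: eq_bigr => i _.
  by rewrite !mxE -expr2 exprMn -exprM mulnC exprM sqrrN expr1n expr1n mul1r.
rewrite ge0_integral_sum//; last 2 first.
- by move=> i; exact: mdet2.
- by move=> i w _; rewrite lee_fin sqr_ge0.
under eq_bigr => i _.
  have gi : gaussian_mx P 1%:M (fun w => row' i (rsubmx (X w))).
    under eq_fun do rewrite row'Esub.
    exact: gaussian_mx_rowsub (@lift_inj _ i) gr.
  rewrite (IH _ gi); over.
by rewrite sumEFin sumr_const card_ord factS natrM mulr_natl.
Qed.

Lemma gaussian_det2 d (S : 'M[R]_d) (X : T -> 'M[R]_d) : posdef S -> gaussian_mx P S X ->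
  (\int[P]_w (\det (X w) ^+ 2)%:E = (d`!%:R * \det S)%:E)%E.
Proof.
move=> pdS gX; have gZ := gaussian_mx_standardize pdS gX; have [mZ _] := gZ.
have uL := chol_unitmx pdS; have [_ _ LL] := chol_posdef pdS.
have detS : \det S = \det (chol S) ^+ 2 by rewrite -{1}LL det_mulmx det_tr.
rewrite EFinM muleC -(gaussian_det2_standard gZ) -ge0_integralZl//; last 3 first.
- exact/measurable_EFinP/measurable_funX/measurable_det.
- by move=> w _; rewrite lee_fin sqr_ge0.
- by rewrite lee_fin ltW// posdef_det_gt0.
apply: eq_integral => w _; rewrite -EFinM; congr _%:E.
by rewrite detS -exprMn -det_mulmx mulKVmx.
Qed.

End gaussian_det.

Lemma finite_roots {R : realType} (p : {poly R}) : p != 0 -> finite_set [set x | root p x].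
Proof.
move=> p0; apply: contrapT => /(@infinite_set_fset _ _ (size p))[B Bp].
apply/negP; rewrite -ltnNge; apply: max_poly_roots p0 _ (finmap.fset_uniq B).
by apply/allP => x xB; exact: Bp.
Qed.

Lemma finite_det_shift {R : realType} d (B : 'M[R]_d) :
  finite_set [set s | \det (B + s%:M) = 0].
Proof.
apply: sub_finite_set (finite_roots (monic_neq0 (char_poly_monic (- B)))) => s /= detBs.
apply/eqP; rewrite -[RHS]detBs /char_poly -[LHS]/(horner_eval s _) -det_map_mx.
congr (\det _); apply/matrixP => i j.
rewrite !mxE /= /horner_eval hornerD hornerN hornerMn hornerX hornerC opprK addrC.
by [].
Qed.

Lemma normal_prob_finite {R : realType} (m s : R) (A : set R) : finite_set A ->
  normal_prob m s A = 0%E.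
Proof.
move=> /finite_set_countable cA; have mA : measurable A by exact: countable_measurable.
have /null_content_dominatesP := normal_prob_dominates m s; apply => //.
exact: countable_lebesgue_measure0.
Qed.

Section gaussian_invertible.
Context {R : realType} {d0 : measure_display} {T : measurableType d0}.
Variable P : probability T R.

Lemma gaussian_det_neq0_standard d (X : T -> 'M[R]_d) : gaussian_mx P 1%:M X ->
  P [set w | \det (X w) = 0] = 0%E.
Proof.
case: d X => [|d] X gX.
  rewrite (_ : mkset _ = set0) ?measure0//; apply/seteqP; split => w //=.
  by rewrite det_mx00 => /eqP; rewrite oner_eq0.
have [mX _] := gX.
pose k : R := (Num.sqrt d.+1%:R)^-1; pose K : 'M[R]_d.+1 := k%:M.
have k0 : k != 0 by rewrite invr_neq0// sqrtr_eq0 -ltNge.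
have qK : qform 1%:M K = 1.
  rewrite /qform mul1mx /mxdot tr_scalar_mx -scalar_mxM mxtrace_scalar -expr2.
  by rewrite /k exprVn sqr_sqrtr// -[LHS]mulr_natr mulVf.
pose f (M : 'M[R]_d.+1) := (\1_[set M | \det M = 0] M : R)%:E.
have mdet0 : measurable [set M : 'M[R]_d.+1 | \det M = 0].
  by apply: measurable_set_eqr => //; apply: measurable_det; exact: measurable_id.
have mf : measurable_fun setT f by apply/measurable_EFinP; exact: measurable_indic.
have f0 M : (0 <= f M)%E by rewrite lee_fin.
transitivity (\int[P]_w f (X w - ((1 - 1) * mxdot K (X w)) *: (1%:M *m K))%R)%E.
  rewrite -[LHS](integral_indic_preimage P mX mdet0).
  by apply: eq_integral => w _; rewrite subrr mul0r scale0r subr0.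
rewrite (ge0_integral_gaussian_shift (trmx1 _ _) gX qK (oner_neq0 R) mf f0).
apply: integral0_eq => w _; set a := mxdot K (X w).
transitivity (\int[normal_prob 0 1]_z
  (\1_((fun z => (z - a) * k) @^-1` [set s | \det (X w + s%:M) = 0]) z)%:E)%E.
  apply: eq_integral => z _; congr (_%:E); rewrite !indicE; congr (_ : bool)%:R.
  by apply/idP/idP; rewrite !inE/= mul1mx scale_scalar_mx.
have fin0 : finite_set ((fun z => (z - a) * k) @^-1` [set s | \det (X w + s%:M) = 0]).
  apply: finite_preimage (finite_det_shift _) => x y _ _ /(mulIf k0)/(addIr (- a)).
  by [].
rewrite integral_indic//; last exact: countable_measurable (finite_set_countable fin0).
by rewrite setIT; exact: normal_prob_finite.
Qed.

Lemma gaussian_det_neq0 d (S : 'M[R]_d) (X : T -> 'M[R]_d) : posdef S -> gaussian_mx P S X ->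
  {ae P, forall w, \det (X w) != 0}.
Proof.
move=> pdS gX; have gZ := gaussian_mx_standardize pdS gX; have [mZ _] := gZ.
exists [set w | \det (invmx (chol S) *m X w) = 0]; split.
- by apply: measurable_set_eqr => //; exact: measurable_det.
- exact: gaussian_det_neq0_standard.
by move=> w /= /negP; rewrite negbK => /eqP detX; rewrite det_mulmx detX mulr0.
Qed.

End gaussian_invertible.

(** * The law of the Gram matrix *)

Section gram_coordinates.
Context {R : realType} {d : nat}.

Definition pair_dir (p : 'I_d * 'I_d) : 'cV[R]_d := delta_mx p.1 0 + delta_mx p.2 0.

(* These coordinates of a symmetric matrix are nonnegative on Gram matrices, as
   required for the uniqueness of Laplace transforms. *)
Definition gram_coord (S : 'M[R]_d) : 'M[R]_d := \matrix_(i, j) qform S (pair_dir (i, j)).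

Definition gram_of_coord (U : 'M[R]_d) : 'M[R]_d :=
  \matrix_(i, j) ((U i j - 4^-1 * U i i - 4^-1 * U j j) / 2).

Lemma gram_coordK (S : 'M[R]_d) : S^T = S -> gram_of_coord (gram_coord S) = S.
Proof.
move=> S_sym; have dotE i j : mxdot (delta_mx i 0 : 'cV[R]_d) (S *m delta_mx j 0) = S i j.
  by rewrite mxdot_delta -colE mxE.
by apply/matrixP => i j; rewrite !mxE /pair_dir !qformD// /qform !dotE; field.
Qed.

Lemma gram_coord_mul n (M : 'M[R]_(d, n)) i j :
  gram_coord (M *m M^T) i j = \sum_k mxdot (pair_dir (i, j)) (col k M) ^+ 2.
Proof.
rewrite mxE /qform -mulmxA mxdot_mull mxdot_cV mxE; apply: eq_bigr => k _.
by rewrite [_^T _ _]mxE -expr2 mxdotC mxdot_cV tr_col -row_mul [row _ _ _ _]mxE.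
Qed.

Lemma gram_coord_ge0 n (M : 'M[R]_(d, n)) i j : 0 <= gram_coord (M *m M^T) i j.
Proof. by rewrite gram_coord_mul sumr_ge0// => k _; exact: sqr_ge0. Qed.

Lemma laplace_gram_coord n (M : 'M[R]_(d, n)) (t : 'I_d * 'I_d -> R) :
  \prod_p expR (- (t p * gram_coord (M *m M^T) p.1 p.2)) =
  \prod_k \prod_p expR (- (t p * mxdot (pair_dir p) (col k M) ^+ 2)).
Proof.
rewrite exchange_big/=; apply: eq_bigr => -[i j] _.
by rewrite gram_coord_mul mulr_sumr -sumrN expR_sum.
Qed.

Lemma measurable_gram_coord {d0} {T : measurableType d0} (S : T -> 'M[R]_d) :
  measurable_fun setT S -> measurable_fun setT (fun x => gram_coord (S x)).
Proof.
move=> mS; apply/measurable_mxP => i j; under eq_fun do rewrite mxE.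
apply: measurable_mxdot; exact: measurable_mulmx mS (measurable_cst _).
Qed.

Lemma measurable_gram_of_coord : measurable_fun setT gram_of_coord.
Proof.
apply/measurable_mxP => i j; under eq_fun do rewrite mxE.
apply: measurable_funM => //; apply: measurable_funB; first apply: measurable_funB.
- exact: measurable_mxentry.
- by apply: measurable_funM => //; exact: measurable_mxentry.
- by apply: measurable_funM => //; exact: measurable_mxentry.
Qed.

End gram_coordinates.

Section gram_law.
Context {R : realType} {d1 d2 : measure_display}
  {T1 : measurableType d1} {T2 : measurableType d2} {d : nat}.
Variables (P1 : probability T1 R) (P2 : probability T2 R) (S : 'M[R]_d).
Variables (M1 : T1 -> 'M[R]_d) (M2 : T2 -> 'M[R]_(d, d + 2)).
Hypotheses (pdS : posdef S) (gM1 : gaussian_mx P1 S M1) (gM2 : gaussian_mx P2 S M2).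

Let mM1 : measurable_fun setT M1. Proof. by case: gM1. Qed.
Let mM2 : measurable_fun setT M2. Proof. by case: gM2. Qed.

Lemma integrable_gaussian_det2 : P1.-integrable setT (EFin \o (fun w => \det (M1 w) ^+ 2)).
Proof.
apply/integrableP; split; first exact/measurable_EFinP/measurable_funX/measurable_det.
under eq_integral do rewrite /= ger0_norm ?sqr_ge0//.
by rewrite (gaussian_det2 pdS gM1) ltry.
Qed.

(* Both sides are multiplied by [\det B ^+ (d + 2)] when the law of the columns is
   tilted: the weight [\det M1 ^+ 2] makes up for the two missing columns. *)
Lemma laplace_gram (t : 'I_d * 'I_d -> R) : (forall p, 0 <= t p) ->
  (\int[P1]_w ((\det (M1 w) ^+ 2)%:E *
     (\prod_p expR (- (t p * gram_coord (M1 w *m (M1 w)^T) p.1 p.2)))%:E) =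
   \int[P2]_w ((d`!%:R * \det S)%:E *
     (\prod_p expR (- (t p * gram_coord (M2 w *m (M2 w)^T) p.1 p.2)))%:E))%E.
Proof.
move=> t_ge0; have [B tiltB] := exists_tilt_prod pdS (index_enum _) pair_dir t_ge0.
set h := (fun x => _) in tiltB; have [B_ge0 _] := tiltB.
have mh : measurable_fun setT h.
  apply: measurable_prod => p _; apply/measurable_expR_funN/measurable_funM => //.
  by apply/measurable_funX/measurable_mxdot; exact: measurable_id.
have h0 v : 0 <= h v by apply: prodr_ge0 => p _; exact: expR_ge0.
under eq_integral do rewrite laplace_gram_coord muleC.
under [RHS]eq_integral do rewrite laplace_gram_coord muleC.
have S_ge0 : 0 <= d`!%:R * \det S by rewrite mulr_ge0// ltW// posdef_det_gt0.
rewrite (tilts_columns mh h0 tiltB (f := fun M => (\det M ^+ 2)%:E) gM1)//; last 2 first.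
- by apply/measurable_EFinP/measurable_funX/measurable_det; exact: measurable_id.
- by move=> M; rewrite lee_fin sqr_ge0.
rewrite (tilts_columns mh h0 tiltB (f := fun=> (d`!%:R * \det S)%:E) gM2)//.
under eq_integral do rewrite det_mulmx exprMn EFinM.
rewrite ge0_integralZl//; last 3 first.
- exact/measurable_EFinP/measurable_funX/measurable_det.
- by move=> w _; rewrite lee_fin sqr_ge0.
- by rewrite lee_fin sqr_ge0.
by rewrite (gaussian_det2 pdS gM1) integral_cst_probability muleA -EFinM -exprD.
Qed.

Lemma gram_law (f : 'M[R]_d -> \bar R) : measurable_fun setT f -> (forall A, 0 <= f A)%E ->
  (\int[P1]_w ((\det (M1 w) ^+ 2)%:E * f (M1 w *m (M1 w)^T)) =
   (d`!%:R * \det S)%:E * \int[P2]_w f (M2 w *m (M2 w)^T))%E.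
Proof.
move=> mf f0; have S_ge0 : 0 <= d`!%:R * \det S.
  by rewrite mulr_ge0// ltW// posdef_det_gt0.
have mgram := measurable_gram mM2.
have iS : P2.-integrable setT (EFin \o (fun=> d`!%:R * \det S)).
  by apply: finite_measure_integrable_cst.
have gramK n (M : 'M[R]_(d, n)) : gram_of_coord (gram_coord (M *m M^T)) = M *m M^T.
  by rewrite gram_coordK// trmx_mul trmxK.
have := weighted_law_laplace_unique (fun=> sqr_ge0 _) (fun=> S_ge0) integrable_gaussian_det2 iS
  (measurable_gram_coord (measurable_gram mM1)) (measurable_gram_coord mgram)
  (fun=> gram_coord_ge0 _) (fun=> gram_coord_ge0 _) laplace_gram
  (measurableT_comp mf measurable_gram_of_coord) (fun=> f0 _).
under eq_integral do rewrite /= gramK.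
under [RHS]eq_integral do rewrite /= gramK.
by rewrite ge0_integralZl//; exact: measurableT_comp mf mgram.
Qed.

End gram_law.

(** * Volume sampling *)

Section volume_sampling.
Context {R : realType} {d1 d2 : measure_display}
  {T1 : measurableType d1} {T2 : measurableType d2} {d : nat}.
Variables (P1 : probability T1 R) (P2 : probability T2 R) (S : 'M[R]_d).
Variables (M1 : T1 -> 'M[R]_d) (M2 : T2 -> 'M[R]_(d, d + 2)).
Hypotheses (pdS : posdef S) (gM1 : gaussian_mx P1 S M1) (gM2 : gaussian_mx P2 S M2).
Variable f : 'M[R]_d -> \bar R.
Hypotheses (mf : measurable_fun setT f) (f0 : forall M, (0 <= f M)%E).

Let mM1 : measurable_fun setT M1. Proof. by case: gM1. Qed.

Let S1 w := M1 w *m (M1 w)^T.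

Let mQ : measurable_fun setT (fun w => orth_factor (M1 w)).
Proof. exact: measurable_orth_factor. Qed.

Let law_M1_mulr (U : 'M[R]_d) : U *m U^T = 1%:M -> same_law P1 (fun w => M1 w *m U) P1 M1.
Proof.
by move=> /mulmx1C UU; exact: gaussian_mx_same_law (gaussian_mx_mulr gM1 UU) gM1.
Qed.

Let measurable_chol_mul {d0} {T : measurableType d0} (A U : T -> 'M[R]_d) :
  measurable_fun setT A -> measurable_fun setT U ->
  measurable_fun setT (fun z => f (chol (A z) *m U z)).
Proof.
move=> mA mU; apply: (measurableT_comp mf).
by apply: measurable_mulmx => //; exact: measurable_chol.
Qed.

Lemma integral_orth_factor_tr (A : 'M[R]_d) :
  (\int[P1]_w f (A *m orth_factor (M1 w)) = \int[P1]_w f (A *m (orth_factor (M1 w))^T))%E.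
Proof.
pose F (z : 'M[R]_d * 'M[R]_d) := f (A *m z.2).
have mF : measurable_fun setT F.
  by apply: (measurableT_comp mf); apply: measurable_mulmx; [exact: measurable_cst|
    exact: measurable_snd].
have := integral_gram_orth_factor mM1 (gaussian_det_neq0 pdS gM1) law_M1_mulr mF (fun=> f0 _).
by rewrite /F/= => ->; rewrite integral_cst_probability.
Qed.

(* [M1 = chol S1 *m orth_factor M1], where the two factors may be taken
   independent and the weight [\det S1] only concerns the first one. *)
Lemma gaussian_volume_sampling :
  ((d`!%:R * \det S)%:E *
     \int[P2]_w2 \int[P1]_w1 f (chol (M2 w2 *m (M2 w2)^T) *m orth_factor (M1 w1)) =
   \int[P1]_w ((\det (M1 w) ^+ 2)%:E * f (M1 w)))%E.
Proof.
have detS1 w : `|\det (S1 w)| = \det (M1 w) ^+ 2.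
  by rewrite det_mulmx det_tr -expr2 ger0_norm ?sqr_ge0.
pose F (z : 'M[R]_d * 'M[R]_d) := (`|\det z.1|%:E * f (chol z.1 *m z.2))%E.
have mF : measurable_fun setT F.
  apply: emeasurable_funM; last exact: measurable_chol_mul.
  apply/measurable_EFinP; apply: measurableT_comp => //; exact: measurable_det.
have F0 z : (0 <= F z)%E by rewrite mule_ge0.
pose G A := (\int[P1]_w f (chol A *m orth_factor (M1 w)))%E.
have mG : measurable_fun setT G.
  apply: (measurable_fun_fubini_tonelli_F (m2 := P1)
    (fun z : 'M[R]_d * T1 => f (chol z.1 *m orth_factor (M1 z.2)))) => //.
  by apply: measurable_chol_mul => //; exact: (measurableT_comp mQ).
have G0 A : (0 <= G A)%E by exact: integral_ge0.
rewrite -(gram_law pdS gM1 gM2 mG G0).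
transitivity (\int[P1]_w F (S1 w, orth_factor (M1 w)))%E.
  have det_neq0 := gaussian_det_neq0 pdS gM1.
  rewrite (integral_gram_orth_factor mM1 det_neq0 law_M1_mulr mF F0).
  apply: eq_integral => w _; rewrite /F/= detS1 ge0_integralZl//.
  - by rewrite /G integral_orth_factor_tr.
  - apply: measurable_chol_mul; first exact: measurable_cst.
    exact: measurable_trmx.
  - by rewrite lee_fin sqr_ge0.
apply: ae_eq_integral => //.
- by apply: (measurableT_comp mF); apply: measurable_fun_pair => //; exact: measurable_gram.
- apply: emeasurable_funM; last exact: measurableT_comp.
  exact/measurable_EFinP/measurable_funX/measurable_det.
apply: filterS (gaussian_det_neq0 pdS gM1) => w detM1 _.
by rewrite /F/= detS1 orth_factorK.
Qed.

End volume_sampling.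

Definition mx_tuple {R : realType} {d n : nat} (M : 'M[R]_(d, n)) : n.-tuple (d.-tuple R) :=
  [tuple tup_of_cV (col j M) | j < n].

Lemma measurable_mx_tuple {R : realType} d n : measurable_fun setT (@mx_tuple R d n).
Proof.
apply/measurable_fun_tnthP => j; rewrite /comp; under eq_fun do rewrite tnth_mktuple.
apply/measurable_fun_tnthP => i; rewrite /comp.
by under eq_fun do rewrite tnth_mktuple mxE; exact: measurable_mxentry.
Qed.

Lemma gram_columns {R : realType} {T : Type} d n (X : 'I_n -> T -> 'cV[R]_d) w :
  columns X w *m (columns X w)^T = \sum_j X j w *m (X j w)^T.
Proof.
apply/matrixP => i j; rewrite summxE mxE; apply: eq_bigr => k _.
by rewrite !mxE big_ord1 !mxE.
Qed.

Section cast_ord_blocks.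
Context {V : Type} {idx : V} {op : Monoid.law idx} {m n k : nat} (mnk : (m + n)%N = k).

Lemma big_ord_lshift (F : 'I_k -> V) :
  \big[op/idx]_(j < k | (j < m)%N) F j = \big[op/idx]_(i < m) F (cast_ord mnk (lshift n i)).
Proof.
move: F; case: _ / mnk => F; rewrite big_split_ord/=.
rewrite [X in op _ X]big_pred0 ?Monoid.mulm1 => [|i]; last by rewrite ltnNge leq_addr.
by apply: eq_big => [i|i _]; rewrite ?ltn_ord ?cast_ord_id.
Qed.

Lemma big_ord_rshift (F : 'I_k -> V) :
  \big[op/idx]_(j < k | (m <= j)%N) F j = \big[op/idx]_(i < n) F (cast_ord mnk (rshift m i)).
Proof.
move: F; case: _ / mnk => F; rewrite big_split_ord/=.
rewrite big_pred0 ?Monoid.mul1m => [|i]; last by rewrite leqNgt ltn_ord.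
by apply: eq_big => [i|i _]; rewrite ?leq_addr ?cast_ord_id.
Qed.

End cast_ord_blocks.

Section block_sampling.
Context {R : realType} {d0 : measure_display} {T : measurableType d0} {d : nat}.
Variables (P : probability T R) (S : 'M[R]_d) (X : T -> 'M[R]_(d, d + (d + 2))).
Hypotheses (pdS : posdef S) (gX : gaussian_mx P S X).

Definition block_resample (M : 'M[R]_(d, d + (d + 2))) : 'M[R]_d :=
  chol (rsubmx M *m (rsubmx M)^T) *m orth_factor (lsubmx M).

Lemma measurable_block_resample : measurable_fun setT block_resample.
Proof.
have ml : measurable_fun setT (fun M : 'M[R]_(d, d + (d + 2)) => lsubmx M).
  by under eq_fun do rewrite lsubmxEsub; apply: measurable_mxsub; exact: measurable_id.
have mr : measurable_fun setT (fun M : 'M[R]_(d, d + (d + 2)) => rsubmx M).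
  by under eq_fun do rewrite rsubmxEsub; apply: measurable_mxsub; exact: measurable_id.
apply: measurable_mulmx; last exact: measurable_orth_factor.
by apply: measurable_chol; exact: measurable_gram.
Qed.

Lemma gaussian_block_resample (f : 'M[R]_d -> \bar R) :
  measurable_fun setT f -> (forall M, 0 <= f M)%E ->
  ((d`!%:R * \det S)%:E * \int[P]_w f (block_resample (X w)) =
   \int[P]_w ((\det (lsubmx (X w)) ^+ 2)%:E * f (lsubmx (X w))))%E.
Proof.
move=> mf f0; have gl := gaussian_mx_lsubmx gX; have gr := gaussian_mx_rsubmx gX.
rewrite -(gaussian_volume_sampling pdS gl gr mf f0); congr (_ * _)%E.
have mfX := measurableT_comp mf measurable_block_resample.
rewrite (ge0_integral_gaussian_blocks gX mfX (fun=> f0 _)).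
apply: eq_integral => w' _; apply: eq_integral => w _.
by rewrite /= /block_resample row_mxKl row_mxKr.
Qed.

Lemma block_resample_law (A : set 'M[R]_d) : measurable A ->
  P [set w | A (block_resample (X w))] =
  (\int[P]_w (\1_A (lsubmx (X w)) * \det (lsubmx (X w)) ^+ 2)%:E *
   ((d`!%:R * \det S)^-1)%:E)%E.
Proof.
move=> mA; have [mX _] := gX.
have mB := measurableT_comp measurable_block_resample mX.
have S_neq0 : d`!%:R * \det S != 0.
  by rewrite mulf_neq0 ?pnatr_eq0 -?lt0n ?fact_gt0// gt_eqF// posdef_det_gt0.
have mf : measurable_fun setT (fun M => (\1_A M : R)%:E).
  by apply/measurable_EFinP; exact: measurable_indic.
have f_ge0 (M : 'M[R]_d) : (0 <= (\1_A M : R)%:E)%E by rewrite lee_fin.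
rewrite -[LHS](integral_indic_preimage P mB mA).
under [in RHS]eq_integral do rewrite mulrC EFinM.
by rewrite -(gaussian_block_resample mf f_ge0) muleAC -EFinM divff// mul1e.
Qed.

End block_sampling.

Section columns_blocks.
Context {R : realType} {T : Type} {d m n k : nat} (mnk : (m + n)%N = k).
Variable X : 'I_k -> T -> 'cV[R]_d.

Lemma gram_lsubmx_columns w :
  lsubmx (columns (X \o cast_ord mnk) w) *m (lsubmx (columns (X \o cast_ord mnk) w))^T =
  \sum_(j < k | (j < m)%N) X j w *m (X j w)^T.
Proof.
rewrite (big_ord_lshift mnk) -(gram_columns (X \o cast_ord mnk \o lshift n)).
by congr (_ *m _^T); apply/matrixP => i j; rewrite !mxE.
Qed.

Lemma gram_rsubmx_columns w :
  rsubmx (columns (X \o cast_ord mnk) w) *m (rsubmx (columns (X \o cast_ord mnk) w))^T =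
  \sum_(j < k | (m <= j)%N) X j w *m (X j w)^T.
Proof.
rewrite (big_ord_rshift mnk) -(gram_columns (X \o cast_ord mnk \o @rshift m n)).
by congr (_ *m _^T); apply/matrixP => i j; rewrite !mxE.
Qed.

End columns_blocks.

Theorem theorem4 (R : realType) (d0 : measure_display)
  (Omega : measurableType d0) (P : probability Omega R)
  (d : nat) (Sigma : 'M[R]_d) (hSigma : posdef Sigma)
  (X : 'I_(2 * d + 2) -> Omega -> 'cV[R]_d)
  (hgauss : forall k, is_gaussian0 P Sigma (X k))
  (hindep : mutually_independent P X) :
  let x := fun (i : 'I_d) w => X (first_block i) w in
  let S1 := fun w => \sum_(j < 2 * d + 2 | (j < d)%N) X j w *m (X j w)^T in
  let S2 := fun w => \sum_(j < 2 * d + 2 | (d <= j)%N) X j w *m (X j w)^T in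
  let xt := fun w : Omega =>
    [tuple tup_of_cV (msqrt (S2 w) *m minvsqrt (S1 w) *m x i w) | i < d] in
  let xs := fun w : Omega => [tuple tup_of_cV (x i w) | i < d] in
  (* VS^d_{D_X}(A) = E_{D_X^d}[1_A det(sum_i x_i x_i^T)] / (d! det Sigma),
     where (x_1,...,x_d) ~ D_X^d *)
  let VS := fun A : set (d.-tuple (d.-tuple R)) =>
    ((\int[P]_w (\1_A (xs w) * \det (S1 w))%:E) *
     ((d`!%:R * \det Sigma)^-1)%:E)%E in
  forall A : set (d.-tuple (d.-tuple R)), measurable A ->
    P (xt @^-1` A) = VS A.
Proof.
move=> x S1 S2 xt xs VS A mA.
have dE : (d + (d + 2) = 2 * d + 2)%N by rewrite mul2n -addnn addnA.
pose M := columns (X \o cast_ord dE).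
have gM : gaussian_mx P Sigma M.
  apply: gaussian_columns => // [k|]; first exact: hgauss.
  exact: mutually_independent_comp (@cast_ord_inj _ _ dE) hindep.
have S1E w : S1 w = lsubmx (M w) *m (lsubmx (M w))^T by rewrite gram_lsubmx_columns.
have S2E w : S2 w = rsubmx (M w) *m (rsubmx (M w))^T by rewrite gram_rsubmx_columns.
have colM w i : col i (lsubmx (M w)) = x i w.
  apply/matrixP => k l; rewrite !mxE ord1; congr (X _ w k 0); exact: val_inj.
have xsE w : xs w = mx_tuple (lsubmx (M w)) by apply: eq_mktuple => i; rewrite colM.
have xtE w : xt w = mx_tuple (block_resample (M w)).
  apply: eq_mktuple => i; rewrite -colM /block_resample /orth_factor -S1E -S2E.
  by rewrite !colE !mulmxA.
have mA' : measurable (mx_tuple @^-1` A) := measurable_preimage (@measurable_mx_tuple R d d) mA.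
rewrite (_ : xt @^-1` A = [set w | (mx_tuple @^-1` A) (block_resample (M w))]).
  rewrite (block_resample_law hSigma gM mA'); congr (_ * _)%E.
  by apply: eq_integral => w _; rewrite xsE S1E det_mulmx det_tr -expr2.
by apply/funext => w /=; rewrite xtE.
Qed.
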